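(* Let $n\ge 4$ and $d,e\in\{1,\dots,n-1\}$ be integers such that $d+e\le n$, and let $j\in\{1,\dots,\min(d,e)\}$. One has $$\mathring\mu_n(d|e)_j\ge \frac{(n-j)\left(jn-jd+\frac{j^2}{2}+\frac j2+1\right)}{j^2(n-e)\left(n-d+\frac j2+\frac12\right)}.$$
   Context: A subspace of $\mathbb{R}^n$ is rational if it has a basis of vectors with rational coordinates; $\mathfrak{R}_n(e)$ denotes the set of rational subspaces of $\mathbb{R}^n$ of dimension $e$. A subspace $A$ of $\mathbb{R}^n$ is $(e,j)$-irrational if $\dim(A\cap B)<j$ for all $B\in\mathfrak{R}_n(e)$; $\mathfrak{I}_n(d,e)_j$ denotes the set of all $(e,j)$-irrational subspaces of dimension $d$ of $\mathbb{R}^n$. Height: for $B\in\mathfrak{R}_n(e)$, let $\Xi\in\mathbb{Z}^N$, $N=\binom ne$, be a vector of Pl\''ucker coordinates of $B$ which is integral with setwise coprime coordinates; $H(B)=\Vert\Xi\Vert$ (Euclidean norm). Equivalently $H(B)$ is the covolume of $B\cap\mathbb{Z}^n$ in $B$. Proximity: $\mathbb{R}^n$ has its standard Euclidean structure. For nonzero $X,Y\in\mathbb{R}^n$, $\psi(X,Y)=\Vert X\wedge Y\Vert/(\Vert X\Vert\,\Vert Y\Vert)$ is the sine of the angle between $X$ and $Y$. For subspaces $A,B$ of $\mathbb{R}^n$ of dimensions $d,e\ge 1$ and $t=\min(d,e)$, define inductively $\psi_1(A,B)=\min\{\psi(X,Y): X\in A\setminus\{0\},Y\in B\setminus\{0\}\}$,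 attained at unit vectors $X_1\in A$, $Y_1\in B$; and, given $(X_1,Y_1),\dots,(X_j,Y_j)$ with $j<t$, let $A_j$ (resp. $B_j$) be the orthogonal complement of $\mathrm{Span}(X_1,\dots,X_j)$ in $A$ (resp. of $\mathrm{Span}(Y_1,\dots,Y_j)$ in $B$), and $\psi_{j+1}(A,B)=\min\{\psi(X,Y): X\in A_j\setminus\{0\},Y\in B_j\setminus\{0\}\}$, attained at unit vectors $X_{j+1},Y_{j+1}$. (These are the sines of the canonical angles between $A$ and $B$ and do not depend on the choices.) Exponents: let $n\ge 2$, $d,e\in\{1,\dots,n-1\}$ with $d+e\le n$, $j\in\{1,\dots,\min(d,e)\}$. For $A\in\mathfrak{I}_n(d,e)_j$, $\mu_n(A|e)_j\in[0,+\infty]$ is the supremum of all $\beta>0$ such that $\psi_j(A,B)\le H(B)^{-\beta}$ holds for infinitely many $B\in\mathfrak{R}_n(e)$. Set $\mathring\mu_n(d|e)_j=\inf_{A\in\mathfrak{I}_n(d,e)_j}\mu_n(A|e)_j$. *)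

(* Defs.v *)
From HB Require Import structures.
From mathcomp Require Import all_boot all_order all_algebra.
From mathcomp Require Import all_classical all_reals all_analysis.
Set Implicit Arguments.
Unset Strict Implicit.
Unset Printing Implicit Defensive.
Import Order.TTheory GRing.Theory Num.Theory.
Local Open Scope classical_set_scope.
Local Open Scope ring_scope.

(* The Euclidean norm; the norm `|x| of MathComp-Analysis on 'rV[R]_n is the
   sup norm. *)
Definition enorm (R : realType) (I : finType) (x : I -> R) : R :=
  Num.sqrt (\sum_i x i ^+ 2).

Definition vnorm (R : realType) (n : nat) (X : 'rV[R]_n) : R :=
  enorm (fun i => X 0 i).

(* The e-element subsets of {0, ..., n-1}, as strictly increasing maps. *)
Definition minor_index (n e : nat) : finType :=
  {f : {ffun 'I_e -> 'I_n} |
     [forall i : 'I_e, forall k : 'I_e, (i < k)%N ==> (f i < f k)%N]}.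

(* Coordinates of X_1 /\ ... /\ X_e in the standard basis of the exterior
   power: the e x e minors of the matrix with rows X_1, ..., X_e. *)
Definition wedge_coord (R : realType) (n e : nat) (X : e.-tuple 'rV[R]_n)
    (I : minor_index n e) : R :=
  \det (\matrix_(i < e, k < e) tnth X i 0 (val I k)).

Definition rational_vector (R : realType) (n : nat) (X : 'rV[R]_n) : Prop :=
  forall k, exists q : rat, X 0 k = ratr q.

Definition rational_subspaces (R : realType) (n e : nat) :
    set {vspace 'rV[R]_n} :=
  [set B | \dim B = e /\
     exists b : e.-tuple 'rV[R]_n,
       basis_of B b /\ forall i, rational_vector (tnth b i)].
Arguments rational_subspaces R n e : clear implicits.

Definition irrational_subspaces (R : realType) (n d e j : nat) :
    set {vspace 'rV[R]_n} :=
  [set A | \dim A = d /\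
     forall B, rational_subspaces R n e B -> (\dim (A :&: B)%VS < j)%N].
Arguments irrational_subspaces R n d e j : clear implicits.

(* Xi is a vector of Plücker coordinates of B (for e >= 1, every nonzero
   multiple of such a vector is again given by a basis of B). *)
Definition plucker_coordinates (R : realType) (n e : nat)
    (B : {vspace 'rV[R]_n}) (Xi : minor_index n e -> R) : Prop :=
  exists b : e.-tuple 'rV[R]_n,
    basis_of B b /\ forall I, Xi I = wedge_coord b I.

Definition primitive_plucker (R : realType) (n e : nat)
    (B : {vspace 'rV[R]_n}) : set {ffun minor_index n e -> int} :=
  [set Xi : {ffun minor_index n e -> int} |
            plucker_coordinates B (fun I => (Xi I)%:~R) /\
            \big[gcdn/0%N]_I `|Xi I|%N = 1%N].
Arguments primitive_plucker {R n} e B.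

(* For B rational of dimension e, primitive_plucker e B consists of two
   opposite vectors, so the height does not depend on the choice. *)
Definition height (R : realType) (n e : nat) (B : {vspace 'rV[R]_n}) : R :=
  let Xi := xget [ffun=> 0] (primitive_plucker e B) in
  enorm (fun I => (Xi I)%:~R : R).
Arguments height {R n} e B.

Definition psi (R : realType) (n : nat) (X Y : 'rV[R]_n) : R :=
  enorm (wedge_coord [tuple X; Y]) / (vnorm X * vnorm Y).

Definition orthogonal_in (R : realType) (n : nat) (A : {vspace 'rV[R]_n})
    (s : seq 'rV[R]_n) : set 'rV[R]_n :=
  [set X | X \in A /\ forall Z, Z \in span s -> \sum_i X 0 i * Z 0 i = 0].

Definition min_pairs (R : realType) (n : nat) (S T : set 'rV[R]_n) :
    set ('rV[R]_n * 'rV[R]_n) :=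
  [set XY | [/\ S XY.1, T XY.2, vnorm XY.1 = 1, vnorm XY.2 = 1 &
     forall X Y, S X -> T Y -> X != 0 -> Y != 0 ->
       psi XY.1 XY.2 <= psi X Y]].

(* The successive pairs (X_1, Y_1), ..., (X_j, Y_j); they exist for
   j <= min (dim A, dim B). *)
Fixpoint canonical_pairs (R : realType) (n : nat) (A B : {vspace 'rV[R]_n})
    (j : nat) : seq ('rV[R]_n * 'rV[R]_n) :=
  if j is j'.+1 then
    let s := canonical_pairs A B j' in
    rcons s (xget (0, 0)
      (min_pairs (orthogonal_in A (unzip1 s)) (orthogonal_in B (unzip2 s))))
  else [::].

(* Indexed from j = 1; meaningful for 1 <= j <= min (dim A, dim B). *)
Definition proximity (R : realType) (n : nat) (A B : {vspace 'rV[R]_n})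
    (j : nat) : R :=
  let XY := last (0, 0) (canonical_pairs A B j) in psi XY.1 XY.2.

(* The supremum is taken in [0, +oo], hence is 0 for an empty set, whereas
   ereal_sup set0 = -oo. *)
Definition mu (R : realType) (n : nat) (A : {vspace 'rV[R]_n}) (e j : nat) :
    \bar R :=
  maxe 0%E (ereal_sup [set beta%:E | beta in [set beta : R | 0 < beta /\
    infinite_set [set B | rational_subspaces R n e B /\
                          proximity A B j <= height e B `^ (- beta)]]]).

Definition mu_ring (R : realType) (n d e j : nat) : \bar R :=
  ereal_inf [set mu A e j | A in irrational_subspaces R n d e j].
Arguments mu_ring R n d e j : clear implicits.

(* Main.v *)
Require Import Defs.
From mathcomp Require Import all_boot all_order all_algebra perm.
From mathcomp Require Import all_classical all_reals all_analysis.
From mathcomp Require Import ring lra zify.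
Import Order.TTheory GRing.Theory Num.Theory.
Import numFieldNormedType.Exports.
Local Open Scope ring_scope.
Set Implicit Arguments.
Unset Strict Implicit.
Unset Printing Implicit Defensive.

(* Idea. A subspace A of dimension d has a basis in reduced echelon form, with
   only n - d free coordinates per vector. Simultaneous approximation of the
   j(n-d) free coordinates of j of these vectors, with common denominator q,
   yields a rational subspace B of dimension j and height O(q^j) all of whose
   vectors are within O(q^(-1-1/(j(n-d)))), relatively, of A. Adding to B, one
   at a time, e - j integral vectors that are close to the current subspace
   (pigeonhole in the quotient lattice) lowers the height exponent from j to
   j(n-e)/(n-j). The resulting exponent is that of the theorem with j(n-d) in
   place of j(n-d) + j(j+1)/2; the gap absorbs all the constants. Irrationality
   makes every psi_j positive, so that infinitely many subspaces arise. *)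

(** Put a = j(n-e)/(n-j), N' = j(n-d) and N = N' + j(j+1)/2. From H(C) << q^a, psi_j(A,C) << 1/(qQ)
    and q <= Q^N' one gets, up to constants, the exponent (1+1/N')/a; the exponent to be proved is
    exactly (1+1/N)/a. Since N > N', a positive power of Q is left over. This is why determinants
    and norms can be bounded crudely throughout, and why the largest minor of an integral matrix can
    stand for the height. The denominator q has no lower bound in terms of Q, so the heights need
    not grow; what tends to 0 is psi_j(A,C), and this is what forces new subspaces to appear. In the
    extension step a vector close to a subspace may lie inside it. Working with a basis of the full
    lattice of integral points of the subspace excludes this, and passing to such a basis only
    decreases the minors. Canonical angles are defined by successive minimisation, so psi_j is
    bounded by induction on j, through test vectors orthogonal to the earlier pairs. *)

Local Notation realmx R A := (map_mx (intr : int -> R) A).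

(** * Pigeonhole and index of integral lattices *)

(** The fractional parts lie in a unit cube cut into [s ^ #|J|] cells of side [1 / s], and two
    points share a cell. This serves both simultaneous approximation and the search for short
    vectors in a quotient lattice. *)
Lemma frac_pigeonhole (R : realType) (T J : finType) (s : nat) (x : T -> J -> R) :
  (0 < s)%N -> (s ^ #|J| < #|T|)%N ->
  exists t1 t2 : T, t1 != t2 /\ exists p : J -> int,
    forall i, `|x t1 i - x t2 i - (p i)%:~R| * s%:R <= 1.
Proof.
move=> s_gt0 cardT.
pose fr (y : R) := y - (Num.floor y)%:~R.
have fr_ge0 y : 0 <= fr y by rewrite subr_ge0 floor_le.
have fr_lt1 y : fr y < 1.
  by rewrite ltrBlDr addrC -[1]/(1%:~R) -intrD; case/andP: (floor_itv y).
have cell_lt y : (Num.truncn (s%:R * fr y) < s)%N.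
  rewrite truncn_lt_nat; last by rewrite mulr_ge0.
  by rewrite gtr_pMr ?ltr0n.
pose cell (t : T) := [ffun i : J => Ordinal (cell_lt (x t i))].
have /injectivePn [t1 [t2 neq eqc]] : ~~ injectiveb cell.
  apply/negP => /injectiveP /leq_card; rewrite card_ffun card_ord.
  by rewrite leqNgt cardT.
exists t1, t2; split=> //.
exists (fun i => Num.floor (x t1 i) - Num.floor (x t2 i)) => i.
have := congr1 (fun f : {ffun J -> 'I_s} => val (f i)) eqc.
rewrite /= !ffunE /=.
have /andP[] := truncn_itv (mulr_ge0 (ler0n R s) (fr_ge0 (x t1 i))).
have /andP[] := truncn_itv (mulr_ge0 (ler0n R s) (fr_ge0 (x t2 i))).
set m2 := Num.truncn (s%:R * fr (x t2 i)); set m1 := Num.truncn _.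
move=> a1 a2 b1 b2 e.
rewrite -[X in _ * X]ger0_norm ?ler0n // -normrM.
rewrite -e in a1 a2; rewrite -!natr1 in a2 b2.
have -> : (x t1 i - x t2 i - (Num.floor (x t1 i) - Num.floor (x t2 i))%:~R) * s%:R
    = s%:R * fr (x t1 i) - s%:R * fr (x t2 i) by rewrite /fr intrB; ring.
rewrite ler_norml; lra.
Qed.

Lemma card_not_codom (k n : nat) (f : 'I_k -> 'I_n) :
  injective f -> #|{: {i : 'I_n | i \notin codom f}}| = (n - k)%N.
Proof.
move=> inj_f; rewrite card_sig -[n in RHS]card_ord -(cardC (mem (codom f))).
by rewrite (card_codom inj_f) card_ord addKn; apply: eq_card => i; rewrite !inE.
Qed.

Lemma eq_nat_of_mul (a b : nat) (w z : int) :
  (a < `|w|)%N -> (b < `|w|)%N -> a%:Z - b%:Z = z * w -> a = b.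
Proof.
move=> la lb E.
have : `|a%:Z - b%:Z|%N = (`|z| * `|w|)%N by rewrite E abszM.
case: (posnP `|z|%N) => [->|z_gt0]; first by rewrite mul0n; lia.
have : (`|w| <= `|z| * `|w|)%N by rewrite leq_pmull.
lia.
Qed.

(** The row lattice of [G] has index [|det G|]. With Smith form [L D S], representatives are [c S]
    with [0 <= c_i < |D_i|]: if a difference is [u G], cancelling [S] leaves congruences modulo each
    [D_i]. For singular [G] the type [T] is empty. *)
Lemma lattice_representatives (k : nat) (G : 'M[int]_k) :
  exists (T : finType) (x : T -> 'rV[int]_k),
    #|T| = `|\det G|%N /\
    forall t1 t2 u, x t1 - x t2 = u *m G -> t1 = t2.
Proof.
have [L uL [S uS [D _ defG]]] := int_Smith_normal_form G.
set Dm : 'M[int]_k := (X in L *m X *m S) in defG.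
have unit1 n (A : 'M[int]_n) : A \in unitmx -> `|\det A|%N = 1%N.
  by rewrite unitmxE => /orP [] /eqP ->.
have DmE : Dm = diag_mx (\row_i D`_i).
  by apply/matrixP => i j; rewrite !mxE.
exists {dffun forall i : 'I_k, 'I_(absz (D`_i))}.
exists (fun t : {dffun forall i : 'I_k, 'I_(absz (D`_i))} =>
  (\row_i (nat_of_ord (t i))%:Z) *m S); split.
  rewrite card_dep_ffun defG !det_mulmx !abszM (unit1 _ L) // (unit1 _ S) //.
  rewrite mul1n muln1 DmE det_diag.
  have -> : absz (\prod_i (\row_i0 D`_i0 : 'rV_k) 0 i) = (\prod_(i < k) absz (D`_i)%R)%N.
    rewrite (big_morph absz abszM absz1); apply: eq_bigr => i _.
    by rewrite mxE.
  rewrite /image_mem -[RHS]big_enum /= foldrE big_map.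
  by apply: eq_bigr => i _; rewrite card_ord.
move=> t1 t2 u; rewrite -mulmxBl defG !mulmxA => /(can_inj (mulmxK uS)).
set c := u *m L => /rowP eqt; apply/ffunP => i; apply/val_inj => /=.
have := eqt i; rewrite DmE mul_mx_diag !mxE.
exact: eq_nat_of_mul (ltn_ord _) (ltn_ord _).
Qed.

(** * Minors of integral matrices *)

Lemma intr_abszE (R : realType) (z : int) : (`|z|%N)%:R = `|z%:~R| :> R.
Proof. by rewrite -intr_norm -abszE. Qed.

(** In a Smith form of [X], the first [k] rows of the right unimodular factor [P] can be taken as
    [S]. They are part of a basis of the integral lattice, so multiplying by the inverse of [P]
    recovers integral coefficients. *)
Lemma saturation (R : realType) (k n : nat) (X : 'M[int]_(k, n)) :
  (k <= n)%N ->
  exists (G : 'M[int]_k) (S : 'M[int]_(k, n)), X = G *m S /\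
    forall (u : 'rV[R]_k) (v : 'rV[int]_n),
      u *m realmx R S = realmx R v -> exists u' : 'rV[int]_k, u = realmx R u'.
Proof.
move=> le_kn; have [L uL [P uP [D _ ->]]] := int_Smith_normal_form X.
exists (L *m diag_mx (\row_i D`_i)), (pid_mx k *m P); split.
  rewrite [RHS]mulmxA -[in RHS](mulmxA L); congr (_ *m _ *m _).
  apply/matrixP => i j; rewrite mul_diag_mx !mxE ltn_ord andbT.
  by case: eqP; rewrite ?mulr1 ?mulr0.
move=> u v; rewrite map_mxM map_pid_mx => E.
exists (v *m invmx P *m pid_mx k).
rewrite !map_mxM -E map_pid_mx -!mulmxA (mulmxA (realmx R P)) -map_mxM mulmxV //.
rewrite map_mx1 mul1mx mul_pid_mx minnn (minn_idPr le_kn).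
by rewrite pid_mx_1 mulmx1.
Qed.

(* All maps f are allowed, not only the increasing ones: this adds only zero
   minors and repetitions up to sign. *)
Definition max_minor (k n : nat) (X : 'M[int]_(k, n)) : nat :=
  \max_(f : {ffun 'I_k -> 'I_n}) `|\det (colsub f X)|%N.

Lemma minor_le (k n : nat) (X : 'M[int]_(k, n)) (f : 'I_k -> 'I_n) :
  (`|\det (colsub f X)| <= max_minor X)%N.
Proof.
have -> : colsub f X = colsub [ffun i => f i] X by apply/matrixP => i j; rewrite !mxE ffunE.
exact: (leq_bigmax (F := fun f : {ffun _} => `|\det (colsub f X)|%N)).
Qed.

Lemma minor_le_real (R : realType) (k n : nat) (X : 'M[int]_(k, n)) (f : 'I_k -> 'I_n) :
  `|\det (colsub f (realmx R X))| <= (max_minor X)%:R.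
Proof.
rewrite -map_mxsub det_map_mx -intr_abszE ler_nat; exact: minor_le.
Qed.

Lemma max_minor_attained (k n : nat) (X : 'M[int]_(k, n)) :
  (0 < max_minor X)%N ->
  exists f : {ffun 'I_k -> 'I_n}, `|\det (colsub f X)|%N = max_minor X.
Proof.
move=> X0; pose F (f : {ffun 'I_k -> 'I_n}) := `|\det (colsub f X)|%N.
have [|f ef] := @bigop.eq_bigmax {ffun 'I_k -> 'I_n} F; last by exists f.
(* If no map from ['I_k] to ['I_n] existed, the maximum would be 0. *)
rewrite lt0n; apply: contraTneq X0 => /card0_eq e; rewrite -leqNgt.
by apply/bigmax_leqP => f; have := e f; rewrite inE.
Qed.

Lemma max_minor_gt0 (R : realType) (k n : nat) (X : 'M[int]_(k, n)) :
  (0 < max_minor X)%N = row_free (realmx R X).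
Proof.
apply/idP/idP => [X_gt0|].
  have [f def_f] := max_minor_attained X_gt0.
  have : 0 < `|\det (colsub f (realmx R X))|.
    by rewrite -map_mxsub det_map_mx -intr_abszE ltr0n def_f.
  rewrite normr_gt0 -unitfE -unitmxE -row_free_unit => /row_freeP [B BE].
  apply/row_freeP; exists (colsub f 1%:M *m B).
  by rewrite mulmxA mulmx_colsub mulmx1.
rewrite /row_free -mxrank_tr => full; apply: leq_trans (minor_le X (fullrankfun full)).
have := fullrowsub_unit full; rewrite unitmxE unitfE absz_gt0.
rewrite -(intr_eq0 R) -det_map_mx map_mxsub -[\det (mxsub _ _ (map_mx _ _))]det_tr.
by rewrite trmx_mxsub.
Qed.

Lemma row_free_col_mx_rV (F : fieldType) (k n : nat) (v : 'rV[F]_n) (S : 'M[F]_(k, n)) :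
  row_free S -> ~~ (v <= S)%MS -> row_free (col_mx v S).
Proof.
move=> /eqP rS nvS; rewrite /row_free eqn_leq rank_leq_row /=.
suff : (\rank S < \rank (col_mx v S))%N by rewrite rS.
by apply: rank_ltmx; rewrite ltmxE -!addsmxE addsmxSr addsmx_sub (negPf nvS).
Qed.

Lemma det_col_mx_rV_le (R : realType) (k n : nat) (w : 'rV[R]_n) (S : 'M[R]_(k, n))
    (c M : R) (g : 'I_(1 + k) -> 'I_n) :
  (forall i, `|w 0 i| <= c) -> (forall f : 'I_k -> 'I_n, `|\det (colsub f S)| <= M) ->
  `|\det (colsub g (col_mx w S))| <= k.+1%:R * (c * M).
Proof.
move=> wc SM; rewrite (expand_det_row _ (0 : 'I_(1 + k))).
apply: le_trans (ler_norm_sum _ _ _) _.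
apply: (@le_trans _ _ (\sum_(i < 1 + k) c * M)).
  apply: ler_sum => i _; rewrite normrM ler_pM //.
    by rewrite !mxE; case: splitP => // l; rewrite (ord1 l).
  rewrite /cofactor normrM normrX normrN1 expr1n mul1r.
  apply: le_trans (SM (g \o lift i)); rewrite le_eqVlt; apply/orP; left.
  apply/eqP; congr (`|\det _|); apply/matrixP => a b; rewrite !mxE /=.
  case: splitP => [l|l]; first by rewrite (ord1 l).
  by rewrite /bump /= !add1n => -[] /val_inj <-.
by rewrite sumr_const card_ord -[leLHS]mulr_natl.
Qed.

Lemma det_colsub_col_mx (F : fieldType) (k n : nat) (v : 'rV[F]_n) (u : 'rV[F]_k)
    (S : 'M[F]_(k, n)) (g : 'I_(1 + k) -> 'I_n) :
  \det (colsub g (col_mx (v - u *m S) S)) = \det (colsub g (col_mx v S)).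
Proof.
have -> : col_mx (v - u *m S) S = block_mx 1%:M (- u) 0 1%:M *m col_mx v S.
  by rewrite mul_block_col !mul1mx mul0mx add0r mulNmx.
by rewrite -mulmx_colsub det_mulmx det_ublock !det1 !mul1r.
Qed.

Lemma colsub_unit_inj (F : fieldType) (k n : nat) (f : 'I_k -> 'I_n) (S : 'M[F]_(k, n)) :
  \det (colsub f S) != 0 -> injective f.
Proof.
move=> dnz a b eqf; apply/eqP; apply: contraNT dnz => neq.
rewrite -det_tr (determinant_alternate neq) // => i.
by rewrite !mxE eqf.
Qed.

(* Let T be an extremal minor of S. The max_minor S classes of 'rV[int]_k
   modulo the rows of T lift to points of the span of S; two of them are close
   modulo 1 in the n - k remaining coordinates, and saturation keeps v out of
   the span. *)
Lemma short_extension (R : realType) (k n : nat) (S : 'M[int]_(k, n)) :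
  (k < n)%N -> (0 < max_minor S)%N ->
  (forall (u : 'rV[R]_k) (v : 'rV[int]_n),
      u *m realmx R S = realmx R v -> exists u' : 'rV[int]_k, u = realmx R u') ->
  exists (s : nat) (v : 'rV[int]_n) (u : 'rV[R]_k),
    [/\ (0 < s)%N, (max_minor S <= s ^ (n - k))%N,
        forall i, `|(realmx R v - u *m realmx R S) 0 i| <= 2 / s%:R &
        row_free (realmx R (col_mx v S))].
Proof.
move=> lt_kn S_gt0 satS.
have freeS : row_free (realmx R S) by rewrite -max_minor_gt0.
have [f def_f] := max_minor_attained S_gt0.
set T := colsub f S in def_f; set TR := realmx R T.
have TRE : TR = colsub f (realmx R S) by rewrite /TR map_mxsub.
have dT : \det TR != 0.
  by rewrite det_map_mx intr_eq0 -absz_gt0 def_f.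
have uT : TR \in unitmx by rewrite unitmxE unitfE.
have inj_f : injective f by apply: (@colsub_unit_inj _ _ _ _ (realmx R S)); rewrite -TRE.
pose J := {i : 'I_n | i \notin codom f}.
have cardJ : #|{: J}| = (n - k)%N by exact: card_not_codom.
(* [s0] is the largest number of subdivisions for which the pigeonhole has more classes than cells.
   The lower bound on [s] holds only for [s = s0.+1]; exchanging one for the other costs the factor
   2 in [2 / s]. *)
have [s0 s0_lt s0_max] : exists2 s0, (s0 ^ (n - k) < max_minor S)%N &
    (max_minor S <= s0.+1 ^ (n - k))%N.
  have ex0 : exists i, (i ^ (n - k) < max_minor S)%N.
    by exists 0%N; rewrite exp0n // subn_gt0.
  have bound i : (i ^ (n - k) < max_minor S)%N -> (i <= max_minor S)%N.
    move=> lt_i; apply: leq_trans (ltnW lt_i).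
    by case: i {lt_i} => // i; rewrite -[leqLHS]expn1 leq_pexp2l ?subn_gt0.
  case: (ex_maxnP ex0 bound) => i Pi max_i; exists i => //.
  by rewrite leqNgt; apply/negP => /max_i; rewrite ltnn.
have colT (u : 'rV[R]_k) : colsub f (u *m realmx R S) = u *m TR.
  by rewrite TRE mulmx_colsub.
exists s0.+1; case: s0 => [|s0] in s0_lt s0_max *.
  (* Here [s = 1] and there are no cells to use. A unit vector supported off the columns of [f] is
     within the allowed bound 2, and a combination of [S] vanishing on these columns is zero. *)
  have /card_gt0P [j _] : (0 < #|{: J}|)%N by rewrite cardJ subn_gt0.
  exists (delta_mx 0 (val j)), 0; split=> // [i|].
    rewrite mul0mx subr0 !mxE eqxx /=; case: (i == _) => /=.
      by rewrite normr1; lra.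
    by rewrite mulr0z normr0; lra.
  rewrite map_col_mx; apply: row_free_col_mx_rV => //; apply/negP => /submxP [u vE].
  have u0 : u = 0.
    apply: (can_inj (mulmxK uT)); rewrite mul0mx -colT -vE.
    apply/rowP => l; rewrite !mxE eqxx /= [f l == _]eq_sym.
    by case: eqP => // e; have := valP j; rewrite /= e codom_f.
  move/rowP: vE => /(_ (val j)); rewrite u0 mul0mx !mxE !eqxx /=.
  by move/eqP; rewrite oner_eq0.
have [Tt [x [cardTt diffx]]] := lattice_representatives T.
(* [b t] is the point of the row space of [S] whose coordinates in the columns of [f] are [x t]. *)
pose b t := realmx R (x t) *m invmx TR *m realmx R S.
have [|t1 [t2 [neq_t [p closep]]]] :=
    @frac_pigeonhole R Tt J s0.+1 (fun t i => b t 0 (val i)) isT.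
  by rewrite cardJ cardTt def_f.
pose u := realmx R (x t1 - x t2) *m invmx TR.
have uSE : u *m realmx R S = b t1 - b t2 by rewrite /u /b map_mxB !mulmxBl.
have uTE : u *m TR = realmx R (x t1 - x t2) by rewrite mulmxKV.
have bf l : (b t1 - b t2) 0 (f l) = ((x t1 - x t2) 0 l)%:~R.
  by have /rowP/(_ l) := uTE; rewrite -colT uSE !mxE.
(* In the columns of [f] the difference [b t1 - b t2] is already integral and the floor is exact, so
   [v] deviates from it only in the columns controlled by the pigeonhole. *)
pose v : 'rV[int]_n := \row_i if insub i is Some j then p (j : J)
                               else Num.floor ((b t1 - b t2) 0 i).
have vf l : v 0 (f l) = (x t1 - x t2) 0 l.
  rewrite /v !mxE insubF; last by rewrite codom_f.
  by have := bf l; rewrite !mxE => ->; rewrite intrKfloor.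
exists v, u; split=> // [i|].
  rewrite ler_pdivlMr ?ltr0n // uSE.
  have s_le : s0.+2%:R <= 2 * s0.+1%:R :> R by rewrite -natrM ler_nat; lia.
  apply: le_trans (ler_wpM2l (normr_ge0 _) s_le) _.
  suff : `|(realmx R v - (b t1 - b t2)) 0 i| * s0.+1%:R <= 1 by lra.
  case i_f : (i \notin codom f).
    have := closep (Sub i i_f); rewrite -normrN !mxE /=.
    by rewrite (insubT (fun i => i \notin codom f) i_f) /= opprB.
  move/negbFE: i_f => /codomP [l ->].
  by rewrite mxE [in X in _ + X]mxE bf [realmx R v _ _]mxE vf subrr normr0 mul0r ler01.
rewrite map_col_mx; apply: row_free_col_mx_rV => //; apply/negP => /submxP [w vE].
have [w' wE] := satS _ _ (esym vE).
case/eqP: neq_t; apply: (diffx _ _ w'); apply/rowP => l; apply: (@intr_inj R).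
have := congr1 (colsub f) vE; rewrite colT wE -map_mxM => /rowP /(_ l).
by rewrite [LHS]mxE [LHS]mxE [RHS]mxE vf.
Qed.

(** * Going up *)

(* The new row v can be replaced by its small component v - u *m S in every
   minor. *)
Lemma going_up_step (R : realType) (k n : nat) (X : 'M[int]_(k, n)) :
  (k < n)%N -> (0 < max_minor X)%N ->
  exists X' : 'M[int]_(1 + k, n),
    [/\ (0 < max_minor X')%N, (realmx R X <= realmx R X')%MS &
      (max_minor X')%:R <=
        (2 * k.+1)%:R * (max_minor X)%:R `^ ((n - k.+1)%:R / (n - k)%:R) :> R].
Proof.
move=> lt_kn X_gt0; have [G [S [XE satS]]] := saturation R X (ltnW lt_kn).
(* All minors of [X] are those of [S] times [det G], so bounds in terms of [S] imply bounds in terms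
   of [X]. *)
have minorGS (f : 'I_k -> 'I_n) : `|\det (colsub f X)|%N = (`|\det G| * `|\det (colsub f S)|)%N.
  by rewrite XE -mulmx_colsub det_mulmx abszM.
have /andP[G_gt0 S_gt0] : (0 < `|\det G|)%N && (0 < max_minor S)%N.
  have [f] := max_minor_attained X_gt0; rewrite minorGS => eqX; move: X_gt0.
  rewrite -eqX muln_gt0 => /andP[-> f_gt0]; exact: leq_trans f_gt0 (minor_le _ _).
have leSX : (max_minor S <= max_minor X)%N.
  have [f <-] := max_minor_attained S_gt0.
  by apply: leq_trans (minor_le X f); rewrite minorGS leq_pmull.
have [s [v [u [s_gt0 Ms short free]]]] := short_extension lt_kn S_gt0 satS.
exists (col_mx v S); split; first by rewrite (max_minor_gt0 R).
  rewrite XE map_mxM map_col_mx; apply: submx_trans (submxMl _ _) _.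
  by rewrite -addsmxE addsmxSr.
have m_gt0 : (0 < n - k)%N by rewrite subn_gt0.
set m := (n - k)%N in Ms m_gt0 *.
(* Expansion along the short row gives [k + 1] terms of size at most [(2 / s) M]; since
   [s >= M^(1/m)], the total is at most [2 (k + 1) M^(1 - 1/m)]. *)
have -> : (n - k.+1)%:R / m%:R = 1 - m%:R^-1 :> R.
  rewrite subnS -/m -subn1 natrB // mulrBl divff ?div1r //.
  by rewrite pnatr_eq0 -lt0n.
set M : R := (max_minor S)%:R; have M_gt0 : 0 < M by rewrite ltr0n.
have root_le : M `^ m%:R^-1 <= s%:R.
  apply: (@le_trans _ _ ((s%:R ^+ m) `^ m%:R^-1)).
    by rewrite ge0_ler_powR ?nnegrE ?invr_ge0 ?ler0n ?exprn_ge0 // -natrX ler_nat.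
  by rewrite -powR_mulrn ?ler0n // -powRrM divff ?powRr1 ?ler0n // pnatr_eq0 -lt0n.
have [g <-] : exists g : {ffun 'I_(1 + k) -> 'I_n},
    `|\det (colsub g (col_mx v S))|%N = max_minor (col_mx v S).
  by apply: max_minor_attained; rewrite (max_minor_gt0 R).
rewrite intr_abszE -det_map_mx map_mxsub map_col_mx -(det_colsub_col_mx _ u).
apply: le_trans (det_col_mx_rV_le _ short (minor_le_real R S)) _.
rewrite -/M [leLHS](_ : _ = (2 * k.+1)%:R * (M / s%:R)); last by rewrite natrM; ring.
rewrite ler_wpM2l ?ler0n //.
apply: (@le_trans _ _ (M `^ (1 - m%:R^-1))).
  rewrite powRD; last by rewrite (gt_eqF M_gt0) implybT.
  rewrite powRr1 ?(ltW M_gt0) // powRN ler_wpM2l ?(ltW M_gt0) //.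
  by rewrite lef_pV2 ?posrE ?powR_gt0 ?ltr0n.
apply: ge0_ler_powR; rewrite ?nnegrE ?ler0n ?ler_nat //.
by rewrite subr_ge0 invf_le1 ?ler1n ?ltr0n.
Qed.

(** The exponents [(n-k-1)/(n-k)] of the successive steps telescope. The constant is chosen before
    [X], so it is uniform in all the matrices produced later. *)
Lemma going_up (R : realType) (k n m : nat) : (k < n)%N -> (m + k <= n)%N ->
  exists2 c : R, 0 < c & forall X : 'M[int]_(k, n), (0 < max_minor X)%N ->
    exists X' : 'M[int]_(m + k, n),
      [/\ (0 < max_minor X')%N, (realmx R X <= realmx R X')%MS &
        (max_minor X')%:R <=
          c * (max_minor X)%:R `^ ((n - (m + k))%:R / (n - k)%:R)].
Proof.
move=> lt_kn; elim: m => [_|m IH le_mkn].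
  exists 1; first exact: ltr01.
  move=> X X_gt0; exists X; split=> //.
  rewrite -[(n - (0 + k))%N]/(n - k)%N divff ?powRr1 ?ler0n ?mul1r //.
  by rewrite pnatr_eq0 -lt0n subn_gt0.
have [c c_gt0 IHc] := IH (ltnW le_mkn).
pose a : R := (n - (m.+1 + k))%:R / (n - (m + k))%:R.
exists ((2 * (m + k).+1)%:R * c `^ a); first by rewrite mulr_gt0 ?powR_gt0 ?ltr0n.
move=> X /IHc [X1 [X1_gt0 sXX1 leX1]].
have [X2 [X2_gt0 sX1X2 leX2]] := going_up_step R le_mkn X1_gt0.
exists X2; split=> //; first exact: submx_trans sX1X2.
apply: le_trans leX2 _; rewrite -mulrA ler_wpM2l ?ler0n // -[_ / _]/a.
apply: (@le_trans _ _ ((c * (max_minor X)%:R `^ ((n - (m + k))%:R / (n - k)%:R)) `^ a)).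
  apply: ge0_ler_powR; rewrite ?nnegrE ?ler0n ?mulr_ge0 ?invr_ge0 ?ler0n ?powR_ge0 //.
  exact: ltW.
rewrite powRM ?powR_ge0 ?(ltW c_gt0) // -powRrM /a mulrCA mulrAC divff ?mul1r //.
by rewrite pnatr_eq0 -lt0n subn_gt0.
Qed.

(** * Euclidean geometry *)

Section Dot.
Variables (R : realType) (n : nat).
Implicit Types (X Y Z : 'rV[R]_n) (A B : {vspace 'rV[R]_n}).

Definition dot X Y : R := \sum_i X 0 i * Y 0 i.

Lemma dotC X Y : dot X Y = dot Y X.
Proof. by apply: eq_bigr => i _; rewrite mulrC. Qed.

Lemma dotDl X Y Z : dot (X + Y) Z = dot X Z + dot Y Z.
Proof. by rewrite -big_split; apply: eq_bigr => i _; rewrite mxE mulrDl. Qed.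

Lemma dotZl a X Z : dot (a *: X) Z = a * dot X Z.
Proof. by rewrite mulr_sumr; apply: eq_bigr => i _; rewrite mxE mulrA. Qed.

Lemma dotNl X Z : dot (- X) Z = - dot X Z.
Proof. by rewrite -scaleN1r dotZl mulN1r. Qed.

Lemma dotDr X Y Z : dot Z (X + Y) = dot Z X + dot Z Y.
Proof. by rewrite dotC dotDl !(dotC Z). Qed.

Lemma dotZr a X Z : dot Z (a *: X) = a * dot Z X.
Proof. by rewrite dotC dotZl (dotC Z). Qed.

Lemma dotNr X Z : dot Z (- X) = - dot Z X.
Proof. by rewrite dotC dotNl (dotC Z). Qed.

Lemma dot0l Z : dot 0 Z = 0.
Proof. by rewrite -(scale0r 0) dotZl mul0r. Qed.

Lemma dot_suml (I : finType) (F : I -> 'rV[R]_n) Z :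
  dot (\sum_i F i) Z = \sum_i dot (F i) Z.
Proof.
by apply: (big_morph (dot^~ Z) (fun X Y => dotDl X Y Z) (dot0l Z)).
Qed.

Lemma dot_ge0 X : 0 <= dot X X.
Proof. by apply: sumr_ge0 => i _; rewrite -expr2 sqr_ge0. Qed.

Lemma dot_eq0 X : (dot X X == 0) = (X == 0).
Proof.
apply/idP/eqP => [|->]; last by rewrite dot0l.
rewrite psumr_eq0 => [/allP X0|i _]; last by rewrite -expr2 sqr_ge0.
apply/rowP => i; rewrite mxE; apply/eqP.
by have := X0 i (mem_index_enum _); rewrite /= mulf_eq0 orbb.
Qed.

Lemma vnormE X : vnorm X = Num.sqrt (dot X X).
Proof. by congr Num.sqrt; apply: eq_bigr => i _; rewrite expr2. Qed.

Lemma vnorm_ge0 X : 0 <= vnorm X.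
Proof. by rewrite vnormE sqrtr_ge0. Qed.

Lemma sqr_vnorm X : vnorm X ^+ 2 = dot X X.
Proof. by rewrite vnormE sqr_sqrtr // dot_ge0. Qed.

Lemma vnorm_eq0 X : (vnorm X == 0) = (X == 0).
Proof. by rewrite -dot_eq0 -sqr_vnorm sqrf_eq0. Qed.

Lemma vnorm_gt0 X : (0 < vnorm X) = (X != 0).
Proof. by rewrite lt_neqAle vnorm_ge0 andbT eq_sym vnorm_eq0. Qed.

Lemma vnorm_unit X : (vnorm X == 1) = (dot X X == 1).
Proof. by rewrite -sqr_vnorm sqrf_eq1 orb_idr // => /eqP e; have := vnorm_ge0 X; lra. Qed.

Lemma wedge2E X Y (I : minor_index n 2) :
  wedge_coord [tuple X; Y] I =
    X 0 (val I ord0) * Y 0 (val I ord_max) - X 0 (val I ord_max) * Y 0 (val I ord0).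
Proof.
rewrite /wedge_coord (expand_det_row _ ord0) !big_ord_recl big_ord0 /cofactor !det_mx11 !mxE.
rewrite (_ : lift ord0 ord0 = ord_max :> 'I_2); last exact: val_inj.
rewrite (_ : lift ord_max ord0 = ord0 :> 'I_2); last exact: val_inj.
rewrite !(tnth_nth 0) /=; ring.
Qed.

Lemma sum_minor_index2 (G : 'I_n -> 'I_n -> R) :
  \sum_(I : minor_index n 2) G (val I ord0) (val I ord_max) =
  \sum_(p : 'I_n * 'I_n | (p.1 < p.2)%N) G p.1 p.2.
Proof.
pose h (I : minor_index n 2) : 'I_n * 'I_n := (val I ord0, val I ord_max).
have inj_h : injective h.
  move=> I K [e0 e1]; apply/val_inj/ffunP => i.
  have [->|->] : i = ord0 \/ i = ord_max.
    by case: i => -[|[|//]] lt; [left|right]; apply: val_inj.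
    exact: e0.
  exact: e1.
rewrite (eq_bigl (mem (h @: [set: minor_index n 2]))) => [|p]; last first.
  apply/idP/imsetP => [lt_p|[I _ ->]]; last first.
    by have /forallP/(_ ord0)/forallP/(_ ord_max)/implyP/= := valP I; apply.
  pose g := [ffun i : 'I_2 => if i == ord0 then p.1 else p.2].
  have okp : [forall i : 'I_2, forall k : 'I_2, (i < k)%N ==> (g i < g k)%N].
    apply/forallP => i; apply/forallP => k; apply/implyP; rewrite !ffunE.
    by case: i k => [[|[|//]] ?] [[|[|//]] ?] //=.
  by exists (exist _ g okp); rewrite ?inE // /h /= !ffunE /=; case: (p).
by rewrite big_imset /= => [|I K _ _]; [apply: eq_bigl => I; rewrite inE|apply: inj_h].
Qed.

(** Summed over all ordered pairs of indices, the squared 2 x 2 minors give twice the right-hand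
    side; the summand is symmetric and vanishes on the diagonal, so the increasing pairs account for
    half. *)
Lemma lagrange_identity X Y :
  enorm (wedge_coord [tuple X; Y]) ^+ 2 = dot X X * dot Y Y - dot X Y ^+ 2.
Proof.
rewrite sqr_sqrtr; last by apply: sumr_ge0 => I _; rewrite sqr_ge0.
pose G i k : R := (X 0 i * Y 0 k - X 0 k * Y 0 i) ^+ 2.
under eq_bigr => I _ do rewrite wedge2E -/(G _ _).
rewrite (sum_minor_index2 G).
have symG : \sum_(p : 'I_n * 'I_n | (p.2 < p.1)%N) G p.1 p.2 =
            \sum_(p : 'I_n * 'I_n | (p.1 < p.2)%N) G p.1 p.2.
  rewrite (reindex_inj (h := fun p : 'I_n * 'I_n => (p.2, p.1))) /=; last first.
    by move=> [a b] [c d] [-> ->].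
  by apply: eq_bigr => p _; rewrite /G; ring.
have diagG : \sum_(p : 'I_n * 'I_n | p.1 == p.2 :> nat) G p.1 p.2 = 0.
  by apply: big1 => p /eqP/val_inj ->; rewrite /G subrr expr0n.
have fullG : \sum_(p : 'I_n * 'I_n) G p.1 p.2 = 2 * (dot X X * dot Y Y - dot X Y ^+ 2).
  rewrite -(pair_bigA _ G) /= /G.
  have -> : \sum_i \sum_j (X 0 i * Y 0 j - X 0 j * Y 0 i) ^+ 2 =
    \sum_i \sum_j ((X 0 i * X 0 i) * (Y 0 j * Y 0 j) + (Y 0 i * Y 0 i) * (X 0 j * X 0 j)
      - 2 * (X 0 i * Y 0 i) * (X 0 j * Y 0 j)).
    by apply: eq_bigr => i _; apply: eq_bigr => j _; ring.
  under eq_bigr => i _ do rewrite big_split big_split /= sumrN -!mulr_sumr -!/(dot _ _).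
  rewrite big_split big_split /= sumrN -!mulr_suml -mulr_sumr -!/(dot _ _).
  ring.
have : \sum_(p : 'I_n * 'I_n) G p.1 p.2 = 2 * \sum_(p : 'I_n * 'I_n | (p.1 < p.2)%N) G p.1 p.2.
  rewrite (bigID (fun p : 'I_n * 'I_n => (p.1 < p.2)%N)) /=.
  rewrite [X in _ + X](bigID (fun p : 'I_n * 'I_n => p.1 == p.2 :> nat)) /=.
  rewrite [X in _ + (X + _)](eq_bigl (fun p : 'I_n * 'I_n => p.1 == p.2 :> nat)) => [|p];
    last by case: ltngtP.
  rewrite diagG add0r [X in _ + X](eq_bigl (fun p : 'I_n * 'I_n => (p.2 < p.1)%N)) => [|p].
    by rewrite symG; ring.
  by case: ltngtP.
by rewrite fullG => E; apply: (@mulfI _ 2); rewrite ?pnatr_eq0.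
Qed.

Lemma dot_sqr_le X Y : dot X Y ^+ 2 <= dot X X * dot Y Y.
Proof. by rewrite -subr_ge0 -lagrange_identity sqr_ge0. Qed.

Lemma dot_le X Y : `|dot X Y| <= vnorm X * vnorm Y.
Proof.
rewrite -ler_sqr ?nnegrE ?normr_ge0 ?mulr_ge0 ?vnorm_ge0 //.
by rewrite real_normK ?num_real // exprMn !sqr_vnorm dot_sqr_le.
Qed.

Lemma psiE X Y :
  psi X Y = Num.sqrt (dot X X * dot Y Y - dot X Y ^+ 2) / (vnorm X * vnorm Y).
Proof. by rewrite -lagrange_identity sqrtr_sqr ger0_norm // sqrtr_ge0. Qed.

Lemma psi_unit X Y : vnorm X = 1 -> vnorm Y = 1 ->
  psi X Y = Num.sqrt (1 - dot X Y ^+ 2).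
Proof. by move=> X1 Y1; rewrite psiE -!sqr_vnorm X1 Y1 expr1n !mulr1 divr1. Qed.

Lemma psi_ge0 X Y : 0 <= psi X Y.
Proof. by rewrite psiE divr_ge0 ?sqrtr_ge0 ?mulr_ge0 ?vnorm_ge0. Qed.

(** For unit [Y] the sine is the distance from [Y] to the line of [X], hence at most the distance to
    [X] itself. *)
Lemma psi_le_dist X Y : X != 0 -> vnorm Y = 1 -> psi X Y <= vnorm (Y - X).
Proof.
move=> X0 Y1; rewrite psiE Y1 mulr1 ler_pdivrMr ?vnorm_gt0 //.
rewrite -ler_sqr ?nnegrE ?sqrtr_ge0 ?mulr_ge0 ?vnorm_ge0 // sqr_sqrtr; last first.
  by rewrite subr_ge0 dot_sqr_le.
have dY : dot Y Y = 1 by rewrite -sqr_vnorm Y1 expr1n.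
rewrite exprMn !sqr_vnorm !(dotDl, dotDr, dotNl, dotNr) (dotC Y X) dY -subr_ge0.
rewrite [X in 0 <= X](_ : _ = (dot X X - dot X Y) ^+ 2) ?sqr_ge0 //; ring.
Qed.

(** The vector on the left is [X] minus its orthogonal projection to the line of [Y]. *)
Lemma unit_vectors_dist X Y : vnorm X = 1 -> vnorm Y = 1 ->
  vnorm (X - dot X Y *: Y) = psi X Y.
Proof.
move=> X1 Y1; rewrite psi_unit // vnormE; congr Num.sqrt.
rewrite !(dotDl, dotDr, dotNl, dotNr, dotZl, dotZr) -!sqr_vnorm X1 Y1 (dotC Y X); ring.
Qed.

Lemma vnorm_triangle X Y : vnorm (X + Y) <= vnorm X + vnorm Y.
Proof.
rewrite -ler_sqr ?nnegrE ?addr_ge0 ?vnorm_ge0 // sqrrD !sqr_vnorm.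
rewrite dotDl !dotDr (dotC Y X).
have := le_trans (ler_norm _) (dot_le X Y); lra.
Qed.

Lemma vnormZ a X : vnorm (a *: X) = `|a| * vnorm X.
Proof. by rewrite !vnormE dotZl dotZr mulrA -expr2 sqrtrM ?sqr_ge0 // sqrtr_sqr. Qed.

Lemma vnorm_sum (I : finType) (F : I -> 'rV[R]_n) :
  vnorm (\sum_i F i) <= \sum_i vnorm (F i).
Proof.
elim/big_ind2: _ => [|X x Y y leX leY|i _ //]; first by rewrite vnormE dot0l sqrtr0.
by apply: le_trans (vnorm_triangle _ _) (lerD leX leY).
Qed.

Lemma vnorm_coord X i : `|X 0 i| <= vnorm X.
Proof.
rewrite -ler_sqr ?nnegrE ?vnorm_ge0 // real_normK ?num_real // sqr_vnorm /dot.
rewrite (bigD1 i) //= -expr2 lerDl; apply: sumr_ge0 => k _.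
by rewrite -expr2 sqr_ge0.
Qed.

Lemma vnorm_le_coord X c : (forall i, `|X 0 i| <= c) -> 0 <= c ->
  vnorm X <= n%:R * c.
Proof.
move=> Xc c0; rewrite [X in vnorm X]row_sum_delta.
apply: le_trans (vnorm_sum _) _.
rewrite -[n in n%:R]card_ord mulr_natl -sumr_const; apply: ler_sum => i _.
rewrite vnormZ [X in _ * X](_ : _ = 1) ?mulr1 //; apply/eqP; rewrite vnorm_unit.
rewrite /dot (bigD1 i) //= big1 => [|k /negPf ki]; rewrite !mxE ?eqxx ?ki /= ?mulr0 //.
by rewrite mulr1 addr0.
Qed.

Lemma orthogonal_inP A (s : seq 'rV[R]_n) X :
  orthogonal_in A s X <-> X \in A /\ forall i, (i < size s)%N -> dot X s`_i = 0.
Proof.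
split=> -[XA orthX]; split=> //.
  by move=> i lt_i; apply: orthX; apply: memv_span; apply: mem_nth.
move=> Z Zs; rewrite -/(dot X Z) (@coord_span _ _ _ (in_tuple s) Z) // dotC dot_suml.
by apply: big1 => i _; rewrite dotZl dotC orthX ?mulr0.
Qed.

Lemma exists_orthogonal A (s : seq 'rV[R]_n) : (size s < \dim A)%N ->
  exists2 X, X != 0 & orthogonal_in A s X.
Proof.
move=> lt_s; set b := vbasis A.
pose M : 'M[R]_(\dim A, size s) := \matrix_(i, k) dot b`_i s`_k.
pose u := nz_row (kermx M).
have u0 : u != 0.
  rewrite nz_row_eq0 kermx_eq0 /row_free; apply: contraTneq lt_s => <-.
  by rewrite -leqNgt rank_leq_col.
have uM : u *m M = 0 by apply/sub_kermxP/nz_row_sub.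
exists (\sum_i u 0 i *: b`_i).
  apply: contra_neq u0 => /freeP u0; apply/rowP => i; rewrite mxE; apply: u0.
  exact: basis_free (vbasisP A).
apply/orthogonal_inP; split.
  by apply: memv_suml => i _; apply: memvZ; apply: vbasis_mem; apply: mem_nth; rewrite size_tuple.
move=> k lt_k; have /rowP/(_ (Ordinal lt_k)) := uM; rewrite !mxE => <-.
by rewrite dot_suml; apply: eq_bigr => i _; rewrite dotZl mxE.
Qed.

End Dot.

(** * Canonical pairs *)

Section Pairs.
Local Open Scope classical_set_scope.
Variables (R : realType) (n : nat).
Implicit Types (X Y Z : 'rV[R]_n) (A B : {vspace 'rV[R]_n}).

Lemma dot_continuous (T : topologicalType) (F G : T -> 'rV[R]_n) :
  continuous F -> continuous G -> continuous (fun t => dot (F t) (G t)).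
Proof.
move=> cF cG; rewrite /dot => t.
apply: cvg_big => [|i _]; [exact: add_continuous|apply: cvgM].
  by apply: (@continuous_comp _ _ _ F (fun M : 'rV[R]_n => M 0 i));
    [exact: cF|exact: coord_continuous].
by apply: (@continuous_comp _ _ _ G (fun M : 'rV[R]_n => M 0 i));
  [exact: cG|exact: coord_continuous].
Qed.

Lemma closed_dot_eq Z c : closed [set X | dot X Z = c].
Proof.
apply: (@closed_comp _ _ (fun X => dot X Z) [set c]); last exact: closed_eq.
by move=> X _; apply: (@dot_continuous _ id (fun=> Z));
  [move=> Y; exact: cvg_id|exact: cst_continuous].
Qed.

Lemma dot_delta X i : dot X (delta_mx 0 i) = X 0 i.
Proof.
rewrite /dot (bigD1 i) //= big1 => [|k /negPf ki]; rewrite !mxE ?eqxx ?ki /= ?mulr0 //.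
by rewrite mulr1 addr0.
Qed.

(** Membership in [A] means being fixed by a linear projection onto [A]. Coordinate by coordinate
    this presents [A] as an intersection of hyperplanes, from which it is closed. *)
Lemma memv_dotP A X :
  X \in A <-> forall i, dot X (\row_k projv A (delta_mx 0 k) 0 i - delta_mx 0 i) = 0.
Proof.
have projE i : dot X (\row_k projv A (delta_mx 0 k) 0 i - delta_mx 0 i) =
    (projv A X) 0 i - X 0 i.
  rewrite dotDr dotNr dot_delta; congr (_ - _).
  rewrite [X in projv A X]row_sum_delta linear_sum summxE.
  by apply: eq_bigr => k _; rewrite linearZ !mxE.
split=> [XA i|XA]; first by rewrite projE projv_id // subrr.
suff <- : projv A X = X by exact: memv_proj.
by apply/rowP => i; apply/eqP; rewrite -subr_eq0 -projE XA.
Qed.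

Lemma orthogonal_in_closed A (s : seq 'rV[R]_n) : closed (orthogonal_in A s).
Proof.
pose W i : 'rV[R]_n := \row_k projv A (delta_mx 0 k) 0 i - delta_mx 0 i.
have -> : orthogonal_in A s =
    (\bigcap_(i in setT) [set X | dot X (W i) = 0])
    `&` (\bigcap_(Z in [set Z | Z \in span s]) [set X | dot X Z = 0]).
  rewrite eqEsubset; split=> X /=.
    by case=> /memv_dotP XA Xs; split=> // i _; apply: XA.
  by case=> XA Xs; split=> //; apply/memv_dotP => i; apply: XA.
by apply: closedI; apply: closed_bigI => *; exact: closed_dot_eq.
Qed.

Lemma unit_sphere_compact : compact [set X : 'rV[R]_n | vnorm X = 1].
Proof.
apply: (@subclosed_compact _ _ [set v : 'rV[R]_n | forall i, `[-1, 1]%classic (v ord0 i)]).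
- rewrite (_ : mkset _ = [set X | dot X X = 1]).
    apply: (@closed_comp _ _ (fun X => dot X X) [set 1]); last exact: closed_eq.
    by move=> X _; apply: (@dot_continuous _ id id) => Y; exact: cvg_id.
  by rewrite eqEsubset; split=> X /= /eqP; [rewrite vnorm_unit|rewrite -vnorm_unit] => /eqP.
- exact: (@rV_compact R n (fun=> `[-1, 1]%classic) (fun=> @segment_compact R _ _)).
move=> X /= X1 i; rewrite in_itv /= -ler_norml -X1; exact: vnorm_coord.
Qed.

(** On unit vectors, minimising [psi] is maximising the squared scalar product, which is continuous
    on a product of compact sets; homogeneity extends the minimum to all nonzero vectors. Existence
    ensures that the [xget] in [canonical_pairs] does not fall back on its default. *)
Lemma min_pairs_nonempty A B (s t : seq 'rV[R]_n) :
  (size s < \dim A)%N -> (size t < \dim B)%N ->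
  exists XY, min_pairs (orthogonal_in A s) (orthogonal_in B t) XY.
Proof.
move=> lt_s lt_t.
pose K (D : {vspace 'rV[R]_n}) r := [set X : 'rV[R]_n | vnorm X = 1] `&` orthogonal_in D r.
have cK D r : compact (K D r).
  by apply: compact_closedI; [exact: unit_sphere_compact|exact: orthogonal_in_closed].
have normK D r X : X != 0 -> orthogonal_in D r X -> K D r ((vnorm X)^-1 *: X).
  move=> X0 /orthogonal_inP [XD Xr]; split.
    by rewrite /= vnormZ ger0_norm ?invr_ge0 ?vnorm_ge0 // mulVf // vnorm_eq0.
  apply/orthogonal_inP; split=> [|i lt_i]; first exact: memvZ.
  by rewrite dotZl Xr ?mulr0.
have [X0 X0n X0A] := exists_orthogonal lt_s.
have [Y0 Y0n Y0B] := exists_orthogonal lt_t.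
have [||[X Y]] := @compact_EVT_max _ R (fun p : 'rV[R]_n * 'rV[R]_n => dot p.1 p.2 * dot p.1 p.2)
    (K A s `*` K B t) _ (compact_setX (cK A s) (cK B t)).
- by exists ((vnorm X0)^-1 *: X0, (vnorm Y0)^-1 *: Y0); split; exact: normK.
- apply: continuous_subspaceT => p.
  have cdot : continuous (fun p : 'rV[R]_n * 'rV[R]_n => dot p.1 p.2).
    by apply: dot_continuous => q; [exact: cvg_fst|exact: cvg_snd].
  by apply: cvgM; exact: cdot.
rewrite inE => -[/= [X1 XA] [Y1 YB]] max_XY.
exists (X, Y); split=> // X' Y' X'A Y'B X'0 Y'0 /=.
have := max_XY ((vnorm X')^-1 *: X', (vnorm Y')^-1 *: Y').
rewrite inE => /(_ (conj (normK _ _ _ X'0 X'A) (normK _ _ _ Y'0 Y'B))) /=.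
rewrite -vnorm_gt0 in X'0; rewrite -vnorm_gt0 in Y'0.
rewrite psi_unit // psiE dotZl dotZr => le_dot.
rewrite ler_pdivlMr ?mulr_gt0 // -[X in _ * X <= _]ger0_norm ?mulr_ge0 ?vnorm_ge0 //.
rewrite -[X in _ * X <= _]sqrtr_sqr -sqrtrM ?ler_sqrt; last 2 first.

- by rewrite subr_ge0 dot_sqr_le.
- by have := dot_sqr_le X Y; rewrite -!sqr_vnorm X1 Y1 expr1n mulr1 subr_ge0.
rewrite -!sqr_vnorm mulrBl mul1r exprMn lerB //.
have eqd : dot X' Y' ^+ 2 = (vnorm X' * vnorm Y') ^+ 2 *
    ((vnorm X')^-1 * ((vnorm Y')^-1 * dot X' Y') * ((vnorm X')^-1 * ((vnorm Y')^-1 * dot X' Y'))).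
  by field; rewrite !gt_eqF.
have := ler_wpM2l (sqr_ge0 (vnorm X' * vnorm Y')) le_dot.
by rewrite -eqd; lra.
Qed.

(** Counted from 0: the pair of index [i] is the one that [proximity A B i.+1] evaluates. *)
Definition canonical_pair A B (i : nat) := last (0, 0) (canonical_pairs A B i.+1).

Lemma canonical_pairsE A B i : canonical_pairs A B i = mkseq (canonical_pair A B) i.
Proof.
elim: i => [//|i IH]; rewrite mkseqS -IH.
by rewrite /canonical_pair /= last_rcons.
Qed.

Lemma canonical_pairP A B i : (i < \dim A)%N -> (i < \dim B)%N ->
  min_pairs (orthogonal_in A (mkseq (fst \o canonical_pair A B) i))
            (orthogonal_in B (mkseq (snd \o canonical_pair A B) i))
            (canonical_pair A B i).
Proof.
move=> ltA ltB; rewrite {3}/canonical_pair /= last_rcons canonical_pairsE.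
rewrite /unzip1 /unzip2 -!map_comp.
by apply: xgetPex; apply: min_pairs_nonempty; rewrite size_mkseq.
Qed.

Lemma proximityE A B j :
  proximity A B j.+1 = psi (canonical_pair A B j).1 (canonical_pair A B j).2.
Proof. by []. Qed.

End Pairs.

(** * Positivity and upper bounds for the proximities *)

Section Proximity.
Variables (R : realType) (n : nat).
Implicit Types (X Y Z : 'rV[R]_n) (A B C : {vspace 'rV[R]_n}).

Local Notation fstp A B i := (canonical_pair A B i).1.
Local Notation sndp A B i := (canonical_pair A B i).2.

Lemma canonical_pair_spec A B i : (i < \dim A)%N -> (i < \dim B)%N ->
  [/\ [/\ fstp A B i \in A, sndp A B i \in B, vnorm (fstp A B i) = 1 & vnorm (sndp A B i) = 1],
      forall l, (l < i)%N -> dot (fstp A B i) (fstp A B l) = 0,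
      forall l, (l < i)%N -> dot (sndp A B i) (sndp A B l) = 0 &
      forall X Y, X \in A -> Y \in B ->
        (forall l, (l < i)%N -> dot X (fstp A B l) = 0) ->
        (forall l, (l < i)%N -> dot Y (sndp A B l) = 0) ->
        X != 0 -> Y != 0 -> psi (fstp A B i) (sndp A B i) <= psi X Y].
Proof.
move=> ltA ltB; have [/orthogonal_inP [XA orthX] /orthogonal_inP [YB orthY] X1 Y1 min_i] :=
  canonical_pairP ltA ltB.
rewrite size_mkseq in orthX; rewrite size_mkseq in orthY.
split=> // [l lt_l|l lt_l|X Y X_A Y_B oX oY X0 Y0].
- by have := orthX l lt_l; rewrite nth_mkseq.
- by have := orthY l lt_l; rewrite nth_mkseq.
- by apply: min_i => //; apply/orthogonal_inP; rewrite size_mkseq; split=> // l lt_l;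
    rewrite nth_mkseq //= ?oX ?oY.
Qed.

(** The pair of index [i] satisfies the weaker orthogonality conditions of index [l], so it competes
    in the minimum defining the earlier pair. *)
Lemma psi_canonical_mono A B l i : (l <= i)%N -> (i < \dim A)%N -> (i < \dim B)%N ->
  psi (fstp A B l) (sndp A B l) <= psi (fstp A B i) (sndp A B i).
Proof.
rewrite leq_eqVlt => /predU1P[->//|lt_li] ltA ltB.
have [[XA YB X1 Y1] oX oY _] := canonical_pair_spec ltA ltB.
have [_ _ _ min_l] := canonical_pair_spec (ltn_trans lt_li ltA) (ltn_trans lt_li ltB).
apply: min_l => // [m lt_m|m lt_m||]; rewrite ?oX ?oY ?(ltn_trans lt_m) //.
  by rewrite -vnorm_gt0 X1.
by rewrite -vnorm_gt0 Y1.
Qed.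

(** If the last sine vanished, so would all earlier ones by monotonicity. Each [X_l] would then be a
    multiple of [Y_l], and the [j.+1] orthonormal vectors [X_l] would lie in the intersection. *)
Lemma proximity_gt0 A B j : (j < \dim A)%N -> (j < \dim B)%N ->
  (\dim (A :&: B) < j.+1)%N -> 0 < proximity A B j.+1.
Proof.
move=> ltA ltB; rewrite ltNge proximityE; apply: contraTN => psi_le0; rewrite -leqNgt.
have ltd l : (l < j.+1)%N -> (l < \dim A)%N /\ (l < \dim B)%N.
  by rewrite ltnS => le_lj; split; apply: leq_ltn_trans le_lj _.
have XAB l : (l < j.+1)%N -> fstp A B l \in (A :&: B)%VS.
  move=> lt_l; have [ltlA ltlB] := ltd l lt_l.
  have [[XA YB X1 Y1] _ _ _] := canonical_pair_spec ltlA ltlB.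
  have psi0 : psi (fstp A B l) (sndp A B l) = 0.
    apply/eqP; rewrite eq_le psi_ge0 andbT.
    exact: le_trans (psi_canonical_mono _ _ _) psi_le0.
  have /eqP := unit_vectors_dist X1 Y1; rewrite psi0 vnorm_eq0 subr_eq0 => /eqP XY.
  by rewrite memv_cap XA XY memvZ.
pose s := mkseq (fun l => fstp A B l) j.+1.
have sz : size s = j.+1 by rewrite size_mkseq.
have free_s : free s.
  rewrite -[s]/(tval (in_tuple s)); apply/freeP => k k0 i.
  have /(congr1 (fun X => dot X (fstp A B i))) := k0; rewrite dot0l dot_suml.
  have lt_i : (i < j.+1)%N by rewrite -sz.
  rewrite (bigD1 i) //= big1 => [|l ne_li].
    have [[_ _ X1 _] _ _ _] := canonical_pair_spec (ltd i lt_i).1 (ltd i lt_i).2.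
    by rewrite dotZl nth_mkseq // addr0 -sqr_vnorm X1 expr1n mulr1.
  have lt_l : (l < j.+1)%N by rewrite -sz.
  rewrite dotZl nth_mkseq //.
  have [[_ _ _ _] oi _ _] := canonical_pair_spec (ltd i lt_i).1 (ltd i lt_i).2.
  have [[_ _ _ _] ol _ _] := canonical_pair_spec (ltd l lt_l).1 (ltd l lt_l).2.
  case: (ltngtP l i) => [lt_li|lt_il|/val_inj e]; last by rewrite e eqxx in ne_li.
    by rewrite dotC oi ?mulr0.
  by rewrite ol ?mulr0.
have : (\dim (span s) <= \dim (A :&: B))%N.
  apply: dimvS; apply/span_subvP => X /mapP [m]; rewrite mem_iota => /andP[_ lt_m] ->.
  exact: XAB.
by have := free_s; rewrite /free size_mkseq => /eqP ->.
Qed.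

(* A vector Z of B orthogonal to the previous Y_l is almost orthogonal to the
   previous X_l, which are close to multiples of the Y_l; hence the projection
   of Z to A, corrected along the X_l, remains close to Z. *)
Lemma proximity_le j : exists2 K : R, 0 <= K &
  forall A B C (eps : R), 0 <= eps -> (B <= C)%VS ->
    (forall Z, Z \in B -> exists2 Z', Z' \in A & vnorm (Z - Z') <= eps * vnorm Z) ->
    forall l, (l < j)%N -> (l < \dim A)%N -> (l < \dim B)%N ->
      psi (fstp A C l) (sndp A C l) <= K * eps.
Proof.
elim: j => [|j [K K0 IH]]; first by exists 0.
(* The distance from [Z] to [Z'] contributes 1. Each of the [j] corrections contributes [1 + K]: 1
   again from [Z - Z'], and [K] from the earlier sine, by induction. *)
pose K' := 1 + j%:R * (1 + K).
have K'1 : 1 <= K' by rewrite lerDl mulr_ge0 // addr_ge0.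
exists (K + K'); first by lra.
move=> A B C eps eps0 sBC approx l; rewrite ltnS leq_eqVlt => /predU1P[->|lt_l] ltA ltB.
  have ltC : (j < \dim C)%N by apply: leq_trans ltB (dimvS sBC).
  have [[XA YC X1 Y1] oX oY min_j] := canonical_pair_spec ltA ltC.
  (* The earlier [Y_m] lie in [C], not necessarily in [B]; still they impose only [j] linear
     conditions, fewer than the dimension of [B]. *)
  have [|Z1 Z1n /orthogonal_inP [Z1B Z1o]] :=
    @exists_orthogonal _ _ B (mkseq (fun l => sndp A C l) j); first by rewrite size_mkseq.
  rewrite size_mkseq in Z1o.
  pose Z := (vnorm Z1)^-1 *: Z1.
  have Z1v : 0 < vnorm Z1 by rewrite vnorm_gt0.
  have Zv : vnorm Z = 1.
    by rewrite vnormZ ger0_norm ?invr_ge0 ?vnorm_ge0 // mulVf // gt_eqF.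
  have ZB : Z \in B by apply: memvZ.
  have Zo m : (m < j)%N -> dot Z (sndp A C m) = 0.
    by move=> lt_m; have := Z1o m lt_m; rewrite nth_mkseq // dotZl => ->; rewrite mulr0.
  have [Z' Z'A] := approx Z ZB; rewrite Zv mulr1 => distZ.
  have old m : (m < j)%N -> [/\ fstp A C m \in A, vnorm (fstp A C m) = 1,
      `|dot Z' (fstp A C m)| <= (1 + K) * eps &
      forall m', (m' < m)%N -> dot (fstp A C m) (fstp A C m') = 0].
    move=> lt_m; have ltmA := ltn_trans lt_m ltA; have ltmB := ltn_trans lt_m ltB.
    have [[XmA YmC Xm1 Ym1] oXm _ _] := canonical_pair_spec ltmA (ltn_trans lt_m ltC).
    (* As [Z] is orthogonal to [Y_m], subtracting from [X_m] its component along [Y_m] does not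
       change the product with [Z], and what remains of [X_m] has norm [psi_m]. *)
    split=> //; rewrite (_ : dot _ _ = - dot (Z - Z') (fstp A C m) +
        dot Z (fstp A C m - dot (fstp A C m) (sndp A C m) *: sndp A C m)); last first.
      by rewrite !(dotDl, dotDr, dotNl, dotNr, dotZr) Zo //; ring.
    rewrite mulrDl mul1r (le_trans (ler_normD _ _)) // lerD //.
      by rewrite normrN (le_trans (dot_le _ _)) // Xm1 mulr1.
    rewrite (le_trans (dot_le _ _)) // Zv mul1r unit_vectors_dist //.
    exact: IH eps0 sBC approx _ lt_m ltmA ltmB.
  pose X := Z' - \sum_(m < j) dot Z' (fstp A C m) *: fstp A C m.
  have XA' : X \in A.
    apply: memvB => //; apply: memv_suml => m _; apply: memvZ.
    by have [] := old m (ltn_ord m).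
  have Xo m : (m < j)%N -> dot X (fstp A C m) = 0.
    move=> lt_m; rewrite dotDl dotNl dot_suml (bigD1 (Ordinal lt_m)) //= big1 => [|l' ne_l].
      have [_ Xm1 _ _] := old m lt_m.
      by rewrite dotZl -[dot (fstp A C m) _]sqr_vnorm Xm1 expr1n mulr1 addr0 subrr.
    rewrite dotZl; case: (ltngtP l' m) => [lt|lt|e].
    - by have [_ _ _ o] := old m lt_m; rewrite (dotC (fstp A C l')) o ?mulr0.
    - by have [_ _ _ o] := old l' (ltn_ord l'); rewrite o ?mulr0.
    - by case/eqP: ne_l; apply: val_inj.
  have distX : vnorm (Z - X) <= K' * eps.
    rewrite /X opprB addrCA addrC (le_trans (vnorm_triangle _ _)) //.
    rewrite /K' mulrDl mul1r lerD // (le_trans (vnorm_sum _)) //.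
    rewrite -[j in j%:R]card_ord -mulrA mulr_natl -sumr_const ler_sum // => m _.
    have [_ Xm1 le_m _] := old m (ltn_ord m).
    by rewrite vnormZ Xm1 mulr1.
  have psi_le : psi (fstp A C j) (sndp A C j) <= K' * eps.
    (* A zero [X] is not admissible in the minimum, but then the distance is 1, which bounds every
       sine. *)
    apply: le_trans distX; have [X0|X0] := eqVneq X 0.
      rewrite X0 subr0 Zv psi_unit // -[leRHS]sqrtr1 ler_wsqrtr //.
      by rewrite gerBl sqr_ge0.
    apply: le_trans (psi_le_dist X0 Zv).
    apply: min_j => //; first exact: (subvP sBC).
    by rewrite -vnorm_gt0 Zv.
  by apply: le_trans psi_le _; rewrite ler_wpM2r // lerDr.
rewrite mulrDl (le_trans (IH _ _ _ _ eps0 sBC approx _ lt_l ltA ltB)) // lerDl mulr_ge0 //; lra.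
Qed.
End Proximity.

(** * Heights *)

Definition rows (R : realType) (k n : nat) (M : 'M[R]_(k, n)) : k.-tuple 'rV[R]_n :=
  [tuple row i M | i < k].

Lemma tnth_rows (R : realType) (k n : nat) (M : 'M[R]_(k, n)) i : tnth (rows M) i = row i M.
Proof. by rewrite tnth_mktuple. Qed.

Lemma nth_rows (R : realType) (k n : nat) (M : 'M[R]_(k, n)) (i : 'I_k) : (rows M)`_i = row i M.
Proof. by rewrite nth_mktuple. Qed.

Lemma mem_span_rows (R : realType) (k n : nat) (M : 'M[R]_(k, n)) (X : 'rV[R]_n) :
  X \in <<rows M>>%VS <-> exists u : 'rV_k, X = u *m M.
Proof.
split=> [/coord_span ->|[u ->]].
  exists (\row_i coord (rows M) i X); rewrite mulmx_sum_row.
  by apply: eq_bigr => i _; rewrite mxE nth_rows.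
rewrite mulmx_sum_row; apply: memv_suml => i _; apply: memvZ; apply: memv_span.
by rewrite -tnth_rows mem_tnth.
Qed.

Lemma span_rowsS (R : realType) (k l n : nat) (M : 'M[R]_(k, n)) (M' : 'M[R]_(l, n)) :
  (M <= M')%MS -> (<<rows M>> <= <<rows M'>>)%VS.
Proof.
case/submxP => D ->; apply/subvP => X /mem_span_rows [u ->].
by apply/mem_span_rows; exists (u *m D); rewrite mulmxA.
Qed.

Lemma free_rows (R : realType) (k n : nat) (M : 'M[R]_(k, n)) :
  row_free M -> free (rows M).
Proof.
move=> freeM; apply/freeP => c c0 i.
suff /rowP/(_ i) : \row_i c i = 0 by rewrite !mxE.
apply: (row_free_inj freeM); rewrite mul0mx mulmx_sum_row -[RHS]c0.
by apply: eq_bigr => l _; rewrite mxE nth_rows.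
Qed.

Lemma basis_rows (R : realType) (k n : nat) (M : 'M[R]_(k, n)) :
  row_free M -> basis_of <<rows M>> (rows M).
Proof. by move=> /free_rows freeM; rewrite basisEfree freeM subvv (eqnP freeM) leqnn. Qed.

Lemma dim_span_rows (R : realType) (k n : nat) (M : 'M[R]_(k, n)) :
  row_free M -> \dim <<rows M>> = k.
Proof. by move/basis_rows/size_basis. Qed.

Lemma wedge_rows (R : realType) (k n : nat) (M : 'M[R]_(k, n)) (I : minor_index n k) :
  wedge_coord (rows M) I = \det (colsub (val I) M).
Proof. by congr (\det _); apply/matrixP => i j; rewrite !mxE tnth_rows mxE. Qed.

Lemma basis_of_rows (R : realType) (k n : nat) (M : 'M[R]_(k, n)) (b : k.-tuple 'rV[R]_n) :
  basis_of <<rows M>> b ->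
  exists P : 'M[R]_k, forall I, wedge_coord b I = \det P * wedge_coord (rows M) I.
Proof.
move=> basb; exists (\matrix_(i, l) coord (rows M) l (tnth b i)) => I.
set P := \matrix_(i, l) _; have bE : b = rows (P *m M).
  apply/eq_from_tnth => i; rewrite tnth_rows row_mul mulmx_sum_row.
  have := basis_mem basb (mem_tnth i b) => /coord_span {1}->.
  by apply: eq_bigr => l _; rewrite !mxE nth_rows.
by rewrite bE !wedge_rows -mulmx_colsub det_mulmx.
Qed.

(** Sorting the image of [f] only permutes the selected columns. This links [max_minor], taken over
    all maps, to the increasing maps that index Plücker coordinates. *)
Lemma increasing_minor (F : comNzRingType) (k n : nat) (M : 'M[F]_(k, n)) (f : 'I_k -> 'I_n) :
  injective f -> \det (colsub f M) != 0 ->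
  exists I : minor_index n k, \det (colsub (val I) M) != 0.
Proof.
move=> inj_f dnz; pose s := enum (mem (codom f)).
have szs : size s = k by rewrite -cardE (card_codom inj_f) card_ord.
pose g := [ffun i => nth (f i) s i].
have sorted_s : sorted (relpre val ltn) s.
  rewrite /s /enum_mem; apply: sorted_filter; first by move=> ? ? ?; exact: ltn_trans.
  by rewrite -sorted_map -enumT val_enum_ord iota_ltn_sorted.
have okg : [forall i : 'I_k, forall l : 'I_k, (i < l)%N ==> (g i < g l)%N].
  apply/forallP => i; apply/forallP => l; apply/implyP => lt_il; rewrite !ffunE.
  rewrite (set_nth_default (f i) (f l)) ?szs //.
  apply: (sorted_ltn_nth _ (f i) sorted_s); rewrite ?inE ?szs //.
  by move=> ? ? ?; exact: ltn_trans.
have fs i : f i \in s by rewrite mem_enum codom_f.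
have lt_h i : (index (f i) s < k)%N by rewrite -[X in (_ < X)%N]szs index_mem.
pose h i := Ordinal (lt_h i).
have fE i : f i = g (h i) by rewrite ffunE /= nth_index.
exists (exist _ g okg) => /=; apply: contraNneq dnz => g0.
have -> : colsub f M = colsub g M *m colsub h 1%:M.
  rewrite mulmx_colsub mulmx1; apply/matrixP => a b.
  by rewrite !mxE fE.
by rewrite det_mulmx g0 mul0r.
Qed.

Lemma enorm_le (R : realType) (I : finType) (x : I -> R) (c : R) :
  (forall i, `|x i| <= c) -> 0 <= c -> enorm x <= #|I|%:R * c.
Proof.
move=> xc c0; rewrite -ler_sqr ?nnegrE ?sqrtr_ge0 ?mulr_ge0 ?ler0n //.
rewrite sqr_sqrtr; last by apply: sumr_ge0 => i _; rewrite sqr_ge0.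
apply: (@le_trans _ _ (\sum_(i : I) c ^+ 2)).
  apply: ler_sum => i _; rewrite -[leLHS]real_normK ?num_real //.
  by rewrite ler_sqr ?nnegrE ?normr_ge0.
rewrite sumr_const -[leLHS]mulr_natl exprMn ler_wpM2r ?sqr_ge0 //.
by rewrite -natrX ler_nat -mulnn; case: (#|I|) => // m; rewrite leq_pmulr.
Qed.

(** The minors of [X] are divided by their gcd [g]. Dividing the first row of [X] by [g] gives a
    real basis with exactly these coordinates, and [k > 0] provides that row. *)
Lemma primitive_plucker_exists (R : realType) (k n : nat) (X : 'M[int]_(k, n)) :
  (0 < k)%N -> (0 < max_minor X)%N ->
  exists Xi, primitive_plucker k <<rows (realmx R X)>> Xi.
Proof.
case: k X => // k X _ X_gt0.
have freeX : row_free (realmx R X) by rewrite -max_minor_gt0.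
have [f def_f] := max_minor_attained X_gt0.
have dnz : \det (colsub f X) != 0 by rewrite -absz_gt0 def_f.
have inj_f : injective f.
  apply: (@colsub_unit_inj _ _ _ _ (realmx R X)).
  by rewrite -map_mxsub det_map_mx intr_eq0.
have [I0 I0nz] := increasing_minor inj_f dnz.
pose Xi I := \det (colsub (val (I : minor_index n k.+1)) X).
pose g := \big[gcdn/0%N]_I `|Xi I|%N.
have dvg I : (g %| `|Xi I|)%N by apply: (biggcdn_inf I).
have g_gt0 : (0 < g)%N.
  by rewrite lt0n; apply: contraNneq I0nz => g0; have := dvg I0; rewrite g0 dvd0n absz_eq0.
exists [ffun I => (Xi I %/ g%:Z)%Z].
have XiE I : (Xi I %/ g%:Z)%Z * g%:Z = Xi I by apply: divzK; rewrite dvdzE.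
split; last first.
  apply/eqP; rewrite -(eqn_pmul2l g_gt0) muln1 -[X in _ == X]/g.
  rewrite (big_morph (muln g) (muln_gcdr g) (muln0 g)); apply/eqP.
  by apply: eq_bigr => I _; rewrite ffunE -[in RHS](XiE I) abszM mulnC.
have gR : (g%:R : R) != 0 by rewrite pnatr_eq0 -lt0n.
pose D : 'M[R]_k.+1 := diag_mx (\row_i if i == ord0 then (g%:R)^-1 else 1).
have detD : \det D = (g%:R)^-1.
  rewrite det_diag (bigD1 ord0) //= mxE eqxx big1 ?mulr1 // => i /negPf i0.
  by rewrite mxE i0.
have uD : D \in unitmx by rewrite unitmxE detD unitfE invr_eq0.
exists (rows (D *m realmx R X)); split.
  have freeDX : row_free (D *m realmx R X).
    by rewrite /row_free mxrankMfree ?mxrank_unit.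
  rewrite basisEdim (dim_span_rows freeX) size_tuple leqnn andbT.
  by apply/span_rowsS/submxP; exists (invmx D); rewrite mulKmx.
move=> I; rewrite wedge_rows -mulmx_colsub det_mulmx detD -map_mxsub det_map_mx ffunE.
by apply: (mulIf gR); rewrite mulrAC mulVf // mul1r -[RHS]/((Xi I)%:~R) -[in RHS](XiE I) intrM.
Qed.

(** A primitive integral vector is shortest among the nonzero integral vectors of its line, and the
    minors of [X] are such a vector. The cardinality factor comes from comparing the Euclidean norm
    with the largest coordinate. *)
Lemma height_le (R : realType) (k n : nat) (X : 'M[int]_(k, n)) :
  (0 < k)%N -> (0 < max_minor X)%N ->
  0 < height k <<rows (realmx R X)>> <= #|minor_index n k|%:R * (max_minor X)%:R.
Proof.
move=> k_gt0 X_gt0; rewrite /height; set Xi := xget _ _.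
have [[b [basb XiE]] gcdXi] : primitive_plucker k <<rows (realmx R X)>> Xi.
  by apply: xgetPex; apply: primitive_plucker_exists.
have [P PE] := basis_of_rows basb.
pose Ti I := \det (colsub (val (I : minor_index n k)) X).
have XiP I : (Xi I)%:~R = \det P * (Ti I)%:~R :> R.
  by rewrite XiE PE wedge_rows -map_mxsub det_map_mx.
have [I0 XiI0] : exists I0, Xi I0 != 0.
  apply/existsP; rewrite -[X in is_true X]negbK negb_exists.
  apply/negP => /forallP Xi0; move: gcdXi; rewrite big1 // => I _.
  by have /negPn/eqP -> := Xi0 I.
apply/andP; split.
  rewrite sqrtr_gt0 (bigD1 I0) //= ltr_pwDl //.
    by rewrite exprn_even_gt0 //= intr_eq0.
  by apply: sumr_ge0 => I _; rewrite sqr_ge0.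
have TiI0 : Ti I0 != 0.
  apply: contra_neq XiI0 => T0; apply/eqP; rewrite -(intr_eq0 R) XiP T0 mulr0 //.
have cross I : Ti I0 * Xi I = Xi I0 * Ti I.
  by apply: (@intr_inj R); rewrite !intrM !XiP; ring.
have P_le1 : `|\det P| <= 1.
  (* As the gcd of [Xi] is 1, [|Ti I0|] is the gcd of the products [Ti I0 * Xi I]; by
     proportionality this is [|Xi I0|] times the gcd of [Ti]. *)
  have le_I0 : (`|Xi I0| <= `|Ti I0|)%N.
    rewrite -[leqRHS]muln1 -gcdXi (big_morph (muln _) (muln_gcdr _) (muln0 _)).
    under eq_bigr => I _ do rewrite -abszM cross abszM.
    rewrite -(big_morph (muln _) (muln_gcdr _) (muln0 _)) leq_pmulr //.
    rewrite lt0n; apply: contra_neq TiI0 => g0; apply/eqP; rewrite -absz_eq0 -dvd0n -g0.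
    exact: (biggcdn_inf I0).
  have := XiP I0; move/(congr1 Num.norm); rewrite normrM -!intr_abszE => E.
  rewrite -(ler_pM2r (x := `|Ti I0|%N%:R)) ?ltr0n ?absz_gt0 //.
  by rewrite -E mul1r ler_nat.
apply: enorm_le => [I|]; last by rewrite ler0n.
rewrite XiP normrM -[leRHS]mul1r ler_pM ?normr_ge0 //.
by rewrite -intr_abszE ler_nat minor_le.
Qed.

(** * Approximation of a subspace *)

(** Among the [Q ^ #|I| + 1] multiples of [alpha] by [0, ..., Q ^ #|I|], two are close modulo 1;
    their difference gives [q]. *)
Lemma dirichlet (R : realType) (I : finType) (alpha : I -> R) (Q : nat) : (0 < Q)%N ->
  exists (q : nat) (p : I -> int), [/\ (0 < q)%N, (q <= Q ^ #|I|)%N &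
    forall i, `|q%:R * alpha i - (p i)%:~R| * Q%:R <= 1].
Proof.
move=> Q_gt0.
have [|t1 [t2 [neq [p closep]]]] := @frac_pigeonhole R 'I_(Q ^ #|I|).+1 I Q
    (fun t i => t%:R * alpha i) Q_gt0; first by rewrite card_ord.
wlog lt_t : t1 t2 p neq closep / (t2 < t1)%N.
  move=> H; case: (ltngtP t1 t2) => [lt|lt|/val_inj e]; last by rewrite e eqxx in neq.
    apply: (H t2 t1 (fun i => - p i)) => // [|i]; first by rewrite eq_sym.
    have := closep i; rewrite -normrN intrN; congr (`|_| * _ <= _); ring.
  exact: (H t1 t2 p).
exists (t1 - t2)%N, p; split=> [||i]; first by rewrite subn_gt0.
  by rewrite (leq_trans (leq_subr _ _)) // -ltnS.
by have := closep i; rewrite natrB ?mulrBl // ltnW.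
Qed.

Lemma reduced_basis (R : realType) (n : nat) (A : {vspace 'rV[R]_n}) :
  exists (f : 'I_(\dim A) -> 'I_n) (Y : 'M[R]_(\dim A, n)),
    [/\ injective f, colsub f Y = 1%:M & forall u, u *m Y \in A].
Proof.
pose M := \matrix_(i < \dim A) (vbasis A)`_i.
have uM u : u *m M = \sum_i u 0 i *: (vbasis A)`_i.
  by rewrite mulmx_sum_row; apply: eq_bigr => i _; rewrite rowK.
have freeM : row_full M^T.
  rewrite /row_full mxrank_tr -/(row_free M) -kermx_eq0 -nz_row_eq0.
  have := nz_row_sub (kermx M) => /sub_kermxP; rewrite uM => u0.
  apply/eqP/rowP => i; rewrite mxE; apply: (freeP _ _ u0).
  exact: basis_free (vbasisP A).
have uf : colsub (fullrankfun freeM) M \in unitmx.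
  by have := fullrowsub_unit freeM; rewrite -unitmx_tr trmx_mxsub trmxK.
exists (fullrankfun freeM), (invmx (colsub (fullrankfun freeM) M) *m M); split.
- exact: fullrankfun_inj.
- by rewrite -mulmx_colsub mulVmx.
move=> u; rewrite mulmxA uM; apply: memv_suml => i _; apply: memvZ.
by apply: vbasis_mem; apply: mem_nth; rewrite size_tuple.
Qed.

Lemma det_le (R : realType) (k : nat) (M : 'M[R]_k) (K : R) :
  (forall i l, `|M i l| <= K) -> `|\det M| <= (k`!)%:R * K ^+ k.
Proof.
move=> MK; apply: le_trans (ler_norm_sum _ _ _) _.
apply: (@le_trans _ _ (\sum_(s : {perm 'I_k}) K ^+ k)).
  apply: ler_sum => s _; rewrite normrM normrX normrN1 expr1n mul1r normr_prod.
  rewrite -[k in K ^+ k]card_ord -prodr_const; apply: ler_prod => i _.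
  by rewrite normr_ge0 MK.
by rewrite sumr_const card_Sn -[leLHS]mulr_natl.
Qed.

(** The pivot columns of [Y] contain only 0 and 1, and [q] times them is integral; they cost
    nothing, so only [j (n - d)] numbers are approximated. The exact block [q] times the identity
    later yields a nonzero minor and controls the coefficients of combinations of the rows. *)
Lemma integral_approximation (R : realType) (d n j : nat) (f : 'I_d -> 'I_n)
    (Y : 'M[R]_(d, n)) (h : 'I_j -> 'I_d) (Q : nat) :
  injective f -> injective h -> colsub f Y = 1%:M -> (0 < Q)%N ->
  exists (q : nat) (X : 'M[int]_(j, n)),
    [/\ (0 < q)%N, (q <= Q ^ (j * (n - d)))%N, colsub (f \o h) X = (q%:Z)%:M &
      forall i k, `|(realmx R X - q%:R *: rowsub h Y) i k| * Q%:R <= 1].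
Proof.
move=> inj_f inj_h Yf Q_gt0; pose J := {k : 'I_n | k \notin codom f}.
have cardJ : #|{: J}| = (n - d)%N by exact: card_not_codom.
have [q [p [q_gt0 q_le close_p]]] :=
  dirichlet (fun ic : 'I_j * J => Y (h ic.1) (val ic.2)) Q_gt0.
have Yfh i l : Y (h i) (f l) = (h i == l)%:R.
  by have /matrixP/(_ (h i) l) := Yf; rewrite !mxE.
pose X := \matrix_(i < j, k < n) if insub k is Some c then p (i, c : J)
                                else Num.floor (q%:R * Y (h i) k).
have Xf i l : X i (f l) = q%:Z * (h i == l)%:R.
  rewrite mxE insubF ?codom_f // Yfh.
  by rewrite (_ : _ * _ = (q%:Z * (h i == l)%:R)%:~R) ?intrKfloor // intrM; case: eqP.
exists q, X; split=> //.
- by rewrite card_prod card_ord cardJ in q_le.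
- apply/matrixP => i l; rewrite mxE Xf mxE (inj_eq inj_h).
  by case: eqP; rewrite ?mulr1 ?mulr0.
move=> i k; case k_f : (k \notin codom f).
  have := close_p (i, Sub k k_f); rewrite distrC !mxE.
  by rewrite (insubT (fun k => k \notin codom f) k_f) /=.
move/negbFE: k_f => /codomP [l ->].
rewrite mxE [realmx R X _ _]mxE Xf !mxE Yfh intrM.
by case: eqP => _; rewrite ?mulr1 ?mulr0 subrr normr0 mul0r ler01.
Qed.

Lemma rational_span_rows (R : realType) (k n : nat) (X : 'M[int]_(k, n)) :
  (0 < max_minor X)%N -> rational_subspaces R n k <<rows (realmx R X)>>%VS.
Proof.
rewrite (max_minor_gt0 R) => freeX; split; first exact: dim_span_rows.
exists (rows (realmx R X)); split; first exact: basis_rows.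
by move=> i l; exists (X i l)%:~R; rewrite tnth_rows !mxE ratr_int.
Qed.

(** Both [q] and [Q] stay visible: the height is governed by [q] alone, the proximity by [q Q], and
    the only link is an upper bound for [q]. The constants depend on [A] but not on [Q]. *)
Lemma good_subspaces (R : realType) (n m j : nat) (A : {vspace 'rV[R]_n}) :
  (0 < j)%N -> (j <= \dim A)%N -> (j < n)%N -> (m + j <= n)%N ->
  exists c1 c2 : R, [/\ 0 < c1, 0 <= c2 &
    forall Q, (0 < Q)%N -> exists (q : nat) (C : {vspace 'rV[R]_n}),
      [/\ (0 < q <= Q ^ (j * (n - \dim A)))%N,
        rational_subspaces R n (m + j) C,
        0 < height (m + j) C <=
          c1 * q%:R `^ (j%:R * ((n - (m + j))%:R / (n - j)%:R)) &
        proximity A C j <= c2 / (q%:R * Q%:R)]].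
Proof.
move=> j_gt0 le_jA lt_jn le_mjn.
have [f [Y [inj_f Yf YA]]] := reduced_basis A.
pose h : 'I_j -> 'I_(\dim A) := widen_ord le_jA.
have inj_h : injective h by move=> a b /(congr1 val) /= e; apply: val_inj.
have [K K0 proxK] := proximity_le R n j.
have [c c_gt0 up] := going_up R lt_jn le_mjn.
(* Entries of [Y] are at most [L - 1], so those of [X], within 1 of multiples by [q >= 1], are at
   most [q L]. A determinant of order [j] then has [j!] terms of size at most [(q L)^j], whence
   [C0]. *)
pose L : R := 1 + \sum_i \sum_k `|Y i k|.
have YL i k : `|Y i k| <= L - 1.
  rewrite /L addrAC subrr add0r (bigD1 i) //= (bigD1 k) //= -addrA lerDl.
  by rewrite addr_ge0 ?sumr_ge0 // => *; rewrite sumr_ge0.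
have L1 : 1 <= L by rewrite lerDl sumr_ge0 // => *; rewrite sumr_ge0.
pose b : R := (n - (m + j))%:R / (n - j)%:R.
have b_ge0 : 0 <= b by rewrite divr_ge0.
pose C0 : R := (j`!)%:R * L ^+ j.
have C0_gt0 : 0 < C0 by rewrite mulr_gt0 ?ltr0n ?fact_gt0 // exprn_gt0 // (lt_le_trans ltr01).
(* The summand 1 only secures positivity. In the second constant, [j] counts the rows combined and
   [n] passes from coordinates to the Euclidean norm. *)
exists (#|minor_index n (m + j)|%:R * (c * C0 `^ b) + 1), (K * (n%:R * j%:R)); split.
- by rewrite ltr_wpDl // !mulr_ge0 ?powR_ge0 ?(ltW c_gt0).
- by rewrite !mulr_ge0.
move=> Q Q_gt0.
have [q [X [q_gt0 q_le Xf Xclose]]] := integral_approximation inj_f inj_h Yf Q_gt0.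
have qR : 0 < q%:R :> R by rewrite ltr0n.
have QR : 0 < Q%:R :> R by rewrite ltr0n.
have Q1 : 1 <= Q%:R :> R by rewrite ler1n.
have q1 : 1 <= q%:R :> R by rewrite ler1n.
have X_gt0 : (0 < max_minor X)%N.
  apply: leq_trans (minor_le X (f \o h)); rewrite Xf det_scalar absz_gt0.
  by rewrite expf_neq0 // -absz_eq0 -lt0n.
have X_le : (max_minor X)%:R <= C0 * q%:R ^+ j :> R.
  have [g <-] := max_minor_attained X_gt0.
  rewrite intr_abszE -det_map_mx map_mxsub /C0 -mulrA -exprMn; apply: det_le => i l.
  have := Xclose i (g l); rewrite !mxE => close.
  have close1 : `|(X i (g l))%:~R - q%:R * Y (h i) (g l)| <= 1.
    by apply: le_trans close; rewrite ler_peMr.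
  rewrite -[leLHS]/(`|(X i (g l))%:~R|).
  rewrite -(subrK (q%:R * Y (h i) (g l)) (X i (g l))%:~R) (le_trans (ler_normD _ _)) //.
  rewrite normrM (ger0_norm (ltW qR)).
  have : q%:R * `|Y (h i) (g l)| <= q%:R * (L - 1) by rewrite ler_wpM2l // ltW.
  by nra.
have [X' [X'_gt0 sXX' X'_le]] := up X X_gt0.
exists q, <<rows (realmx R X')>>%VS; split.
- by rewrite q_gt0 q_le.
- exact: rational_span_rows.
- have mj_gt0 : (0 < m + j)%N by rewrite addn_gt0 j_gt0 orbT.
  have /andP[-> h_le] /= := height_le R mj_gt0 X'_gt0.
  apply: le_trans h_le _.
  apply: (@le_trans _ _ (#|minor_index n (m + j)|%:R * (c * C0 `^ b) * q%:R `^ (j%:R * b))).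
    rewrite -mulrA ler_wpM2l // (le_trans X'_le) // -mulrA ler_wpM2l ?(ltW c_gt0) //.
    rewrite powRrM powR_mulrn ?ler0n // -powRM ?(ltW C0_gt0) ?exprn_ge0 ?ler0n //.
    by apply: ge0_ler_powR; rewrite ?nnegrE ?ler0n // mulr_ge0 ?exprn_ge0 ?(ltW C0_gt0).
  by rewrite ler_wpM2r ?powR_ge0 // lerDl.
have approx Z : Z \in <<rows (realmx R X)>>%VS ->
    exists2 Z', Z' \in A & vnorm (Z - Z') <= n%:R * j%:R / (q%:R * Q%:R) * vnorm Z.
  case/mem_span_rows => u ZE; exists (q%:R *: (u *m rowsub h Y)).
    apply: memvZ; rewrite (_ : rowsub h Y = rowsub h 1%:M *m Y) ?mulmxA ?YA //.
    by rewrite -{1}[Y]mul1mx mxsub_mul mxsub_id.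
  (* In the columns [f \o h] the vector [Z = u X] is exactly [q u]. This division by [q] produces
     the factor [1 / q] of the proximity, and the row errors produce [1 / Q]. *)
  have u_le i : `|u 0 i| <= vnorm Z / q%:R.
    have /rowP/(_ i) : colsub (f \o h) Z = q%:R *: u.
      by rewrite ZE -mulmx_colsub -map_mxsub Xf map_scalar_mx mul_mx_scalar.
    rewrite !mxE => Zfi; have := vnorm_coord Z (f (h i)).
    by rewrite Zfi normrM (ger0_norm (ltW qR)) ler_pdivlMr // mulrC.
  have -> : n%:R * j%:R / (q%:R * Q%:R) * vnorm Z =
      n%:R * (j%:R * (vnorm Z / q%:R * Q%:R^-1)) by field; rewrite !gt_eqF.
  apply: vnorm_le_coord => [k|]; last by rewrite !mulr_ge0 ?invr_ge0 ?vnorm_ge0 ?ler0n.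
  rewrite {1}ZE scalemxAr -mulmxBr mxE (le_trans (ler_norm_sum _ _ _)) //.
  apply: (@le_trans _ _ (\sum_(i < j) vnorm Z / q%:R * Q%:R^-1)); last first.
    by rewrite sumr_const card_ord -[leLHS]mulr_natl.
  apply: ler_sum => i _.
  rewrite normrM ler_pM ?normr_ge0 //.
  by rewrite -[_^-1]mul1r ler_pdivlMr.
have dX : \dim <<rows (realmx R X)>>%VS = j by apply: dim_span_rows; rewrite -max_minor_gt0.
have -> C : proximity A C j = psi (canonical_pair A C j.-1).1 (canonical_pair A C j.-1).2.
  by rewrite -proximityE prednK.
rewrite -mulrA.
by apply: proxK (span_rowsS sXX') approx _ _ _ _; rewrite ?dX ?prednK.
Qed.

(** * Comparison of exponents and conclusion *)

Lemma seq_positive_lower_bound (R : realType) (T : eqType) (g : T -> R) (s : seq T) :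
  (forall t, t \in s -> 0 < g t) -> exists2 delta, 0 < delta & forall t, t \in s -> delta <= g t.
Proof.
elim: s => [|t s IH] g_gt0; first by exists 1.
have [|delta delta_gt0 le_delta] := IH; first by move=> u us; rewrite g_gt0 // inE us orbT.
exists (Num.min delta (g t)); first by rewrite lt_min delta_gt0 g_gt0 ?mem_head.
move=> u; rewrite inE => /predU1P[->|us]; first by rewrite ge_min lexx orbT.
by rewrite ge_min le_delta.
Qed.

Lemma le_powR_large (R : realType) (c theta : R) : 0 < theta ->
  exists2 Q0 : nat, (0 < Q0)%N & forall Q, (Q0 <= Q)%N -> c <= Q%:R `^ theta.
Proof.
move=> theta_gt0; exists (Num.truncn (`|c| `^ theta^-1)).+1 => // Q le_Q.
apply: le_trans (ler_norm c) _.
have -> : `|c| = (`|c| `^ theta^-1) `^ theta.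
  by rewrite -powRrM mulVf ?gt_eqF // powRr1.
apply: ge0_ler_powR; rewrite ?nnegrE ?powR_ge0 ?ler0n ?(ltW theta_gt0) //.
apply: (@le_trans _ _ (Num.truncn (`|c| `^ theta^-1)).+1%:R); last by rewrite ler_nat.
by have /andP[_ /ltW] := truncn_itv (powR_ge0 `|c| theta^-1).
Qed.

(** Split [q^(a r)] as [q] times [q^(a r - 1)]. The second factor is at most [Q^(N (a r - 1))], and
    the largeness condition on [Q] leaves room for the constants, so [c2 H^r <= q Q]. *)
Lemma exponent_bound (R : realType) (c1 c2 a r H : R) (N Q q : nat) :
  0 < c1 -> 0 <= c2 -> 0 < r -> 1 <= a * r ->
  c2 * c1 `^ r <= Q%:R `^ (1 - N%:R * (a * r - 1)) ->
  (0 < Q)%N -> (0 < q <= Q ^ N)%N -> 0 < H <= c1 * q%:R `^ a ->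
  c2 / (q%:R * Q%:R) <= H `^ (- r).
Proof.
move=> c1_gt0 c2_ge0 r_gt0 ar1 largeQ Q_gt0 /andP[q_gt0 q_le] /andP[H_gt0 H_le].
have qR : 0 < q%:R :> R by rewrite ltr0n.
have QR : 0 < Q%:R :> R by rewrite ltr0n.
have HrE : H `^ r <= c1 `^ r * (q%:R * q%:R `^ (a * r - 1)).
  apply: (@le_trans _ _ ((c1 * q%:R `^ a) `^ r)).
    by apply: ge0_ler_powR; rewrite ?nnegrE ?(ltW r_gt0) ?(ltW H_gt0) // (le_trans (ltW H_gt0)).
  rewrite powRM ?powR_ge0 ?(ltW c1_gt0) // -powRrM ler_wpM2l ?powR_ge0 //.
  rewrite -{2}[q%:R]powRr1 ?ler0n // -powRD; last by rewrite (gt_eqF qR) implybT.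
  by rewrite addrC subrK.
have q_pow : q%:R `^ (a * r - 1) <= Q%:R `^ (N%:R * (a * r - 1)).
  rewrite powRrM powR_mulrn ?ler0n //; apply: ge0_ler_powR.
  - by rewrite subr_ge0.
  - by rewrite nnegrE ler0n.
  - by rewrite nnegrE exprn_ge0.
  - by rewrite -natrX ler_nat.
rewrite powRN ler_pdivrMr ?mulr_gt0 // [leRHS]mulrC ler_pdivlMr ?powR_gt0 //.
apply: le_trans (ler_wpM2l c2_ge0 HrE) _.
rewrite [leLHS](_ : _ = q%:R * ((c2 * c1 `^ r) * q%:R `^ (a * r - 1))); last by ring.
rewrite ler_wpM2l ?(ltW qR) //.
apply: le_trans (ler_pM _ _ largeQ q_pow) _; rewrite ?mulr_ge0 ?powR_ge0 //.
rewrite -powRD; last by rewrite (gt_eqF QR) implybT.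
by rewrite subrK powRr1 ?ler0n.
Qed.

Theorem theorem1p8 (R : realType) (n d e j : nat)
    (hn : (4 <= n)%N)
    (hd : (1 <= d <= n - 1)%N) (he : (1 <= e <= n - 1)%N)
    (hde : (d + e <= n)%N)
    (hj : (1 <= j <= minn d e)%N) :
  ((((n%:R - j%:R)
      * (j%:R * n%:R - j%:R * d%:R + j%:R ^+ 2 / 2 + j%:R / 2 + 1))
    / (j%:R ^+ 2 * (n%:R - e%:R) * (n%:R - d%:R + j%:R / 2 + 1 / 2)) : R)%:E
   <= mu_ring R n d e j)%E.
Proof.
apply: le_ereal_inf_tmp => _ [A [dimA irrA] <-].
set r : R := (X in X%:E); rewrite /mu le_max; apply/orP; right.
apply: ereal_sup_ubound; exists r => //.
have [j_gt0 le_jd le_je] : [/\ (0 < j)%N, (j <= d)%N & (j <= e)%N].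
  by move: hj; rewrite leq_min => /and3P[].
have [lt_dn lt_en] : (d < n)%N /\ (e < n)%N by lia.
have lt_jn : (j < n)%N := leq_ltn_trans le_jd lt_dn.
have j1 : 1 <= j%:R :> R by rewrite ler1n.
have dn : d%:R + 1 <= n%:R :> R by rewrite natr1 ler_nat.
have en : e%:R + 1 <= n%:R :> R by rewrite natr1 ler_nat.
have jn : j%:R + 1 <= n%:R :> R by rewrite natr1 ler_nat.
(* With this [N] the numerator of the exponent is [(n - j)(N + 1)] and the denominator
   [j (n - e) N], so that [a r = 1 + 1/N] for the height exponent [a]. *)
pose N : R := j%:R * (n%:R - d%:R + j%:R / 2 + 1 / 2).
have N_gt0 : 0 < N by rewrite mulr_gt0 //; lra.
have r_gt0 : 0 < r.
  rewrite divr_gt0 //; last by rewrite !mulr_gt0 ?exprn_gt0 //; lra.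
  rewrite mulr_gt0 //; first by lra.
  rewrite -mulrBr; have : 0 <= j%:R * (n%:R - d%:R) :> R by rewrite mulr_ge0 //; lra.
  by have : 0 <= j%:R ^+ 2 :> R by []; lra.
pose a : R := j%:R * ((n - e)%:R / (n - j)%:R).
have arE : a * r = 1 + N^-1.
  rewrite /a /r /N !natrB ?(ltnW lt_en) ?(ltnW lt_jn) //; field.
  by rewrite !gt_eqF //; lra.
split=> //.
have le_jA : (j <= \dim A)%N by rewrite dimA.
have le_mjn : (e - j + j <= n)%N by rewrite subnK // ltnW.
have [c1 [c2 [c1_gt0 c2_ge0 good]]] := good_subspaces j_gt0 le_jA lt_jn le_mjn.
rewrite subnK // dimA in good.
(* The left-over power of [Q] is [1 - j (n - d) / N], positive because [N] exceeds [j (n - d)] by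
   [j (j + 1) / 2]. *)
have theta_gt0 : 0 < 1 - (j * (n - d))%:R * (a * r - 1).
  rewrite arE addrAC subrr add0r subr_gt0 ltr_pdivrMr // mul1r natrM natrB ?(ltnW lt_dn) //.
  by rewrite /N ltr_pM2l //; lra.
have [Q0 Q0_gt0 largeQ] := le_powR_large (c2 * c1 `^ r) theta_gt0.
have ar1 : 1 <= a * r by rewrite arE lerDl invr_ge0 ltW.
have prox_gt0 C : rational_subspaces R n e C -> 0 < proximity A C j.
  move=> ratC; rewrite -(prednK j_gt0); apply: proximity_gt0.
  - by rewrite prednK.
  - by rewrite ratC.1 prednK.
  - by rewrite prednK //; exact: irrA.
(* If only finitely many subspaces qualified, their positive proximities would have a common lower
   bound [delta]. *)
case/finite_seqP => s sE.
have [C Cs|delta delta_gt0 le_delta] :=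
    seq_positive_lower_bound (g := fun C => proximity A C j) (s := s).
  by apply: prox_gt0; have : [set` s]%classic C by []; rewrite -sE => -[].
(* Beyond [Q0] the subspace produced qualifies; beyond [c2 / delta] its proximity is below [delta],
   whatever [q >= 1] is. *)
pose Q := maxn Q0 (Num.truncn (c2 / delta)).+1.
have Q_gt0 : (0 < Q)%N by rewrite leq_max Q0_gt0.
have [q [C [/andP[q_gt0 q_le] ratC C_le prox_le]]] := good Q Q_gt0.
have Cs : C \in s.
  suff : [set` s]%classic C by []; rewrite -sE; split=> //; apply: le_trans prox_le _.
  apply: (exponent_bound (N := (j * (n - d))%N) c1_gt0 c2_ge0 r_gt0 ar1 _ Q_gt0 _ C_le);
    last by rewrite q_gt0.
  by apply: largeQ; rewrite leq_maxl.
have := le_delta C Cs; rewrite leNgt => /negP; apply.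
apply: le_lt_trans prox_le _.
rewrite ltr_pdivrMr ?mulr_gt0 ?ltr0n // mulrC -ltr_pdivrMr //.
have : c2 / delta < Q%:R.
  apply: (@lt_le_trans _ _ (Num.truncn (c2 / delta)).+1%:R).
    by have /andP[] := truncn_itv (divr_ge0 c2_ge0 (ltW delta_gt0)).
  by rewrite ler_nat leq_maxr.
move/lt_le_trans; apply; rewrite ler_peMl ?ler0n // ler1n //.
Qed.
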